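(* Let $f\in\mathbf{R}[y]$ be a monic irreducible quasi-ordinary polynomial of degree $n$ in $y$, let $d_1,\ldots,d_h,d_{h+1}=1$ be its gcd-sequence, and let $r_1,\ldots,r_h$ be the associated sequence. Then $O(f,\mathrm{App}_{d_k}(f))=r_k$ for all $1\le k\le h$.
   Context: $\mathbf{K}$ is an algebraically closed field of characteristic $0$ and $\mathbf{R}=\mathbf{K}[[x_1,\ldots,x_e]]$. Quasi-ordinary polynomials. A monic $f=y^n+a_1(\underline{x})y^{n-1}+\cdots+a_n(\underline{x})\in\mathbf{R}[y]$ is quasi-ordinary if its discriminant with respect to $y$ has the form $x_1^{N_1}\cdots x_e^{N_e}u(\underline{x})$ with $N_i\in\mathbf{N}$ and $u$ a unit of $\mathbf{R}$. If $f$ is moreover irreducible in $\mathbf{R}[y]$, then by the Abhyankar–Jung theorem there is $y(\underline{t})=\sum_p c_p\underline{t}^p\in\mathbf{K}[[t_1,\ldots,t_e]]$ with $f(t_1^n,\ldots,t_e^n,y(\underline{t}))=0$, and the $n$ roots of $f(t_1^n,\ldots,t_e^n,y)=0$ are of the form $y(w_1t_1,\ldots,w_et_e)$ with $w_1,\ldots,w_e$ $n$-th roots of unity in $\mathbf{K}$. Characteristic exponents. There is a finite sequence $m_1,\ldots,m_h$ of elements of $\mathrm{Supp}(f)=\{p: c_p\ne0\}$ (the characteristic exponents of $f$) such that: $m_1<m_2<\cdots<m_h$ coordinate-wise ($a<b$ means $a\le b$ in each coordinate and $a\neq b$); if $c_p\neq0$ then $p\in(n\mathbf{Z})^e+\sum_{|m_i|\le|p|}m_i\mathbf{Z}$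 (where $|p|$ is the sum of the coordinates of $p$); and $m_i\notin(n\mathbf{Z})^e+\sum_{j<i}m_j\mathbf{Z}$ for all $i$. Associated sequences. $D_1=n^e$, and for $1\le i\le h$, $D_{i+1}$ is the gcd of the $e\times e$ minors of the $e\times(e+i)$ matrix $(nI_e,m_1^T,\ldots,m_i^T)$; $e_i=D_i/D_{i+1}$. One has $D_{h+1}=n^{e-1}$; put $d_i=D_i/D_{h+1}$ (gcd-sequence), so $d_1=n$, $d_{h+1}=1$. Finally $r_1=m_1$ and $r_{k+1}=e_kr_k+m_{k+1}-m_k$ for $1\le k\le h-1$. Order. For nonzero $u\in\mathbf{K}[[\underline{t}]]$, $\mathrm{In}(u)$ is the nonzero homogeneous component of $u$ of smallest total degree, and $\exp(u)$ is the greatest exponent, for the lexicographical order, of a monomial occurring in $\mathrm{In}(u)$. For $g\in\mathbf{R}[y]$ with $g(t_1^n,\ldots,t_e^n,y(\underline{t}))\ne0$, $O(f,g)=\exp\big(g(t_1^n,\ldots,t_e^n,y(\underline{t}))\big)$ (independent of the chosen root). Approximate roots. For a divisor $d$ of $n$, the $d$-th approximate root $\mathrm{App}_d(f)$ is the unique monic polynomial $g\in\mathbf{R}[y]$ of degree $n/d$ in $y$ such that $\deg_y(f-g^d)<n-n/d$. *)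

(* Defs.v *)
From HB Require Import structures.
From mathcomp Require Import all_boot all_order all_algebra.
From mathcomp Require Import boolp.
From mathcomp Require Import mpoly.

Set Implicit Arguments.
Unset Strict Implicit.
Unset Printing Implicit Defensive.

Import Order.TTheory GRing.Theory.
Local Open Scope ring_scope.

Record mseries (R : Type) (e : nat) := MSeries {
  scoef :> 'X_{1..e} -> R
}.

Section Structure.
Variables (R : Type) (e : nat).

HB.instance Definition _ := gen_eqMixin (mseries R e).
HB.instance Definition _ := gen_choiceMixin (mseries R e).

Lemma mseriesP (u v : mseries R e) : u =1 v -> u = v.
Proof. by case: u v => [u] [v] /= /funext ->. Qed.

End Structure.

Section Ring.
Variables (R : comNzRingType) (e : nat).
Implicit Types u v w : mseries R e.

Definition szero : mseries R e := MSeries (fun _ => 0).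
Definition sopp u := MSeries (fun m => - u m).
Definition sadd u v := MSeries (fun m => u m + v m).

Fact saddA : associative sadd.
Proof. by move=> u v w; apply/mseriesP => m; rewrite /= addrA. Qed.
Fact saddC : commutative sadd.
Proof. by move=> u v; apply/mseriesP => m; rewrite /= addrC. Qed.
Fact sadd0 : left_id szero sadd.
Proof. by move=> u; apply/mseriesP => m; rewrite /= add0r. Qed.
Fact saddN : left_inverse szero sopp sadd.
Proof. by move=> u; apply/mseriesP => m; rewrite /= addNr. Qed.

HB.instance Definition _ :=
  GRing.isZmodule.Build (mseries R e) saddA saddC sadd0 saddN.

Definition smono (N : 'X_{1..e}) : mseries R e :=
  MSeries (fun m => (m == N)%:R).

(* The degree bounds only serve to make the index type finite: every pair
   with k.1 + k.2 = m satisfies them. *)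
Definition smul u v : mseries R e := MSeries (fun m =>
  \sum_(k : 'X_{1..e < (mdeg m).+1, (mdeg m).+1} | m == (k.1 + k.2)%MM)
    u k.1 * v k.2).

Definition strunc d u : {mpoly R[e]} :=
  \sum_(k : 'X_{1..e < d}) u k *: 'X_[k].

Lemma mcoeff_strunc d u m :
  (strunc d u)@_m = if (mdeg m < d)%N then u m else 0.
Proof.
rewrite /strunc raddf_sum /=; case: ifP => md.
  rewrite (bigD1 (BMultinom md)) //= mcoeffZ mcoeffX eqxx mulr1 big1 ?addr0 //.
  by move=> i; rewrite bmeqP /= => /negPf ni; rewrite mcoeffZ mcoeffX ni mulr0.
rewrite big1 // => i _; rewrite mcoeffZ mcoeffX; case: eqP => [im|]; last first.
  by rewrite mulr0.
by have := bmdeg i; rewrite im md.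
Qed.

Lemma mcoeffM_eq (p p' q q' : {mpoly R[e]}) m :
  (forall k, (mdeg k <= mdeg m)%N -> p@_k = p'@_k) ->
  (forall k, (mdeg k <= mdeg m)%N -> q@_k = q'@_k) ->
  (p * q)@_m = (p' * q')@_m.
Proof.
move=> pp' qq'; rewrite !mcoeffM; apply: eq_bigr => k _.
by rewrite pp' ?qq' // -ltnS bmdeg.
Qed.

Lemma smulE d u v m : (mdeg m < d)%N ->
  smul u v m = (strunc d u * strunc d v)@_m.
Proof.
move=> md; rewrite mcoeffM; apply: eq_bigr => k _.
by rewrite !mcoeff_strunc !(leq_trans (bmdeg _) md).
Qed.

Fact smulA : associative smul.
Proof.
move=> u v w; apply/mseriesP => m; set d := (mdeg m).+1.
have T a b k : (mdeg k <= mdeg m)%N ->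
    (strunc d (smul a b))@_k = (strunc d a * strunc d b)@_k.
  by move=> km; rewrite mcoeff_strunc ltnS km (@smulE d).
rewrite !(@smulE d) //.
rewrite (@mcoeffM_eq _ (strunc d u) _ (strunc d v * strunc d w)) //; last exact: T.
rewrite mulrA; apply/esym/mcoeffM_eq => // k km; exact: T.
Qed.

Fact smulC : commutative smul.
Proof.
by move=> u v; apply/mseriesP => m; rewrite !(@smulE (mdeg m).+1) // mulrC.
Qed.

Fact smul1 : left_id (smono 0) smul.
Proof.
move=> u; apply/mseriesP => m; rewrite (@smulE (mdeg m).+1) //.
rewrite (@mcoeffM_eq _ 1 _ (strunc (mdeg m).+1 u)) //.
  by rewrite mul1r mcoeff_strunc ltnSn.
by move=> k km; rewrite mcoeff_strunc ltnS km mcoeff1.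
Qed.

Fact smulDl : left_distributive smul sadd.
Proof.
move=> u v w; apply/mseriesP => m /=; rewrite -big_split /=.
by apply: eq_bigr => k _; rewrite mulrDl.
Qed.

Fact sone_neq0 : smono 0 != 0.
Proof.
apply/eqP => /(congr1 (fun u : mseries R e => u 0%MM)) /= /eqP.
by rewrite eqxx oner_eq0.
Qed.

HB.instance Definition _ := GRing.Zmodule_isComNzRing.Build (mseries R e)
  smulA smulC smul1 smulDl sone_neq0.

Definition sunit : {pred mseries R e} := fun u => `[< exists v, v * u = 1 >].
Definition sinv u : mseries R e :=
  if pselect (exists v, v * u = 1) is left ex then sval (cid ex) else u.

Fact smulV : {in sunit, left_inverse 1 sinv *%R}.
Proof.
move=> u /asboolP ex; rewrite /sinv; case: pselect => // ex'.
exact: (svalP (cid ex')).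
Qed.
Fact sunitP u v : v * u = 1 -> sunit u.
Proof. by move=> vu; apply/asboolP; exists v. Qed.
Fact sinv_out : {in [predC sunit], sinv =1 id}.
Proof.
move=> u; rewrite inE => /asboolP ex; rewrite /sinv; case: pselect => // ex'.
Qed.

HB.instance Definition _ := GRing.ComNzRing_hasMulInverse.Build (mseries R e)
  smulV sunitP sinv_out.

End Ring.

Section Domain.
Variables (R : idomainType) (e : nat).
Implicit Types u v : mseries R e.

Lemma smin_ex u : u != 0 -> exists2 m, u m != 0 &
  forall k, (k < m)%O -> u k = 0.
Proof.
move=> u0; have [m um] : exists m, u m != 0.
  apply: contrapT => nex; case/eqP: u0; apply/mseriesP => m /=.
  by apply/eqP; apply: contrapT => /negP um; apply: nex; exists m.
elim/(@ltmwf e): m um => m IH um.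
case: (pselect (exists2 k, (k < m)%O & u k != 0)) => [[k km uk]|nex].
  exact: IH km uk.
exists m => // k km; apply/eqP; apply: contrapT => /negP uk.
by apply: nex; exists k.
Qed.

Fact smul_eq0 u v : u * v = 0 -> (u == 0) || (v == 0).
Proof.
move=> uv; apply: contrapT => /negP; rewrite negb_or => /andP[u0 v0].
have [a ua amin] := smin_ex u0; have [b vb bmin] := smin_ex v0.
have abd : (mdeg a < (mdeg (a + b)%MM).+1)%N /\ (mdeg b < (mdeg (a + b)%MM).+1)%N.
  by rewrite !ltnS mdegD leq_addr leq_addl.
have := congr1 (fun w : mseries R e => w (a + b)%MM) uv.
rewrite [LHS]/= (bigD1 (BMultinom abd.1, BMultinom abd.2)) //= big1 ?addr0.
  by move/eqP; rewrite mulf_eq0 (negPf ua) (negPf vb).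
case=> k l /= /andP[/eqP abE kl].
case: (ltgtP (k : 'X_{1..e}) a) => [ka|ak|ka]; first by rewrite amin // mul0r.
  case: (ltP (l : 'X_{1..e}) b) => [lb|bl]; first by rewrite bmin // mulr0.
  by have := ltmc_le_add ak bl; rewrite -abE ltxx.
case/negP: kl; move/eqP: abE; rewrite ka eqm_add2l => /eqP bl.
by rewrite xpair_eqE !bmeqP /= ka -bl !eqxx.
Qed.

HB.instance Definition _ :=
  GRing.ComUnitRing_isIntegral.Build (mseries R e) smul_eq0.

End Domain.

Definition irreducible_elt (A : unitRingType) (a : A) :=
  [/\ a != 0, a \isn't a GRing.unit
    & forall b c, a = b * c -> b \is a GRing.unit \/ c \is a GRing.unit].

(* This is the discriminant for monic [f] in characteristic 0, where [f^`()]
   has the expected degree and no division by the leading coefficient is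
   needed. *)
Definition discr (A : comNzRingType) (f : {poly A}) : A :=
  (-1) ^+ 'C((size f).-1, 2) * resultant f f^`().

Definition quasi_ordinary (R : idomainType) e (f : {poly mseries R e}) :=
  exists (N : 'X_{1..e}) (u : mseries R e),
    u \is a GRing.unit /\ discr f = smono R N * u.

(* u(t_1^n, ..., t_e^n) *)
Definition spow (R : comNzRingType) e (n : nat) (u : mseries R e) :
  mseries R e :=
  MSeries (fun m => if [forall i, n %| m i]%N
                    then u [multinom (m i %/ n)%N | i < e] else 0).

(* g(t_1^n, ..., t_e^n, y(t)); only the coefficients are substituted by spow *)
Definition subst_eval (R : comNzRingType) e (n : nat)
  (g : {poly mseries R e}) (y : mseries R e) : mseries R e :=
  (map_poly (spow n) g).[y].

(* A sequence [m] of length h is indexed from 0, so that [nth 0%MM m i] is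
   the (i+1)-st exponent; likewise [Dseq n m i], [eseq n m i], [dseq n m i]
   and [rseq n m i] are D_(i+1), e_(i+1), d_(i+1) and r_(i+1). *)

(* p belongs to (nZ)^e + sum_(i | J i) m_i Z, stated coordinate by coordinate *)
Definition in_lattice e (n : nat) (m : seq 'X_{1..e}) (J : pred nat)
    (p : 'X_{1..e}) :=
  exists (z : 'I_e -> int) (c : nat -> int), forall a : 'I_e,
    (p a)%:Z = n%:Z * z a
             + \sum_(0 <= i < size m | J i) (nth 0%MM m i a)%:Z * c i.

Definition char_exponents (R : comNzRingType) e (n : nat)
    (y : mseries R e) (m : seq 'X_{1..e}) :=
  [/\ forall i, (i < size m)%N -> y (nth 0%MM m i) != 0,
      forall i j, (i < j < size m)%N ->
        (nth 0%MM m i <= nth 0%MM m j)%MM /\ nth 0%MM m i <> nth 0%MM m j,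
      forall p, y p != 0 ->
        in_lattice n m (fun i => mdeg (nth 0%MM m i) <= mdeg p)%N p
    & forall i, (i < size m)%N ->
        ~ in_lattice n m (fun j => j < i)%N (nth 0%MM m i)].

Definition gcd_minors p q (A : 'M[int]_(p, q)) : nat :=
  \big[gcdn/0%N]_(g : {ffun 'I_p -> 'I_q} |
      [forall i : 'I_p, forall j : 'I_p, (i < j)%N ==> (g i < g j)%N])
    `|\det (colsub g A)|%N.

(* (n I_e, m_1^T, ..., m_i^T): the exponents are columns *)
Definition char_mx e (n : nat) (m : seq 'X_{1..e}) (i : nat) :
  'M[int]_(e, e + i) :=
  row_mx (n%:Z)%:M (\matrix_(a < e, j < i) (nth 0%MM m j a)%:Z).

Definition Dseq e (n : nat) (m : seq 'X_{1..e}) (i : nat) : nat :=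
  if i is 0 then (n ^ e)%N else gcd_minors (char_mx n m i).

Definition eseq e n (m : seq 'X_{1..e}) i : nat :=
  (Dseq n m i %/ Dseq n m i.+1)%N.

Definition dseq e n (m : seq 'X_{1..e}) i : nat :=
  (Dseq n m i %/ Dseq n m (size m))%N.

(* The truncated difference of multinomials is exact here, because
   characteristic exponents increase coordinate-wise. *)
Fixpoint rseq e n (m : seq 'X_{1..e}) (k : nat) : 'X_{1..e} :=
  if k is k'.+1
  then (rseq n m k' *+ eseq n m k' + (nth 0 m k - nth 0 m k'))%MM
  else nth 0%MM m 0.

Definition shomog (R : comNzRingType) e (u : mseries R e) (d : nat) :
  mseries R e := MSeries (fun p => if mdeg p == d then u p else 0).

(* v = In(u), as a relation because In(0) is undefined *)
Definition is_init (R : comNzRingType) e (u v : mseries R e) :=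
  exists d, [/\ v = shomog u d, v != 0
              & forall d', (d' < d)%N -> shomog u d' = 0].

Definition lexle e (p q : 'X_{1..e}) : bool :=
  @Order.le _ (e.-tuplelexi nat) (val p) (val q).

(* exp(u) is defined and equal to p; this fails for every p when u = 0 *)
Definition is_exp (R : comNzRingType) e (u : mseries R e) (p : 'X_{1..e}) :=
  exists2 v, is_init u v &
    v p != 0 /\ forall q, v q != 0 -> lexle q p.

(* g(t^n, y(t)) is nonzero and O(f, g) = p, when n = deg f and y is a root of
   f(t^n, _); [f] itself enters only through [n] and [y]. *)
Definition is_O (R : comNzRingType) e (n : nat) (y : mseries R e)
  (g : {poly mseries R e}) (p : 'X_{1..e}) := is_exp (subst_eval n g y) p.

Definition is_app_root (A : idomainType) (d : nat) (f g : {poly A}) :=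
  let n := (size f).-1 in
  [/\ g \is monic, size g = (n %/ d).+1
    & (size (f - g ^+ d)%R <= n - n %/ d)%N].

(* App_d(f), with junk value 0 in case there is none *)
Definition app_root (A : idomainType) (d : nat) (f : {poly A}) : {poly A} :=
  if pselect (exists g, is_app_root d f g) is left ex then sval (cid ex)
  else 0.

(* Main.v *)
Require Import Defs.
From HB Require Import structures.
From mathcomp Require Import all_boot all_order all_algebra all_fingroup.
From mathcomp Require Import separable cyclic.
From mathcomp Require Import boolp mpoly.
From mathcomp Require Import zify.
Import Order.TTheory GRing.Theory.
Local Open Scope ring_scope.
Set Implicit Arguments.
Unset Strict Implicit.
Unset Printing Implicit Defensive.

(** Substituting x = t^n splits the irreducible polynomial f into the linear
    factors Y - z, where z runs over the conjugates of the root y under the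
    group G of e-tuples of n-th roots of unity, acting by rescaling t
    (irreducible_conjs_poly).  Indices of sequences start at 0.  Let H_k be the
    subgroup of G fixing the monomials t^(m_j) for j < k.  The Smith normal form
    of the matrix (n I, m_0, ..., m_(k-1)) shows that H_k has order D_k
    (card_Hset) and that H_k moves t^(m_k) (Hset_separates).  Since every
    exponent of y lies in the lattice of all the m_j, the stabilizer of y is
    the last of these subgroups (stab_y), so d = d_k is the number of
    conjugates of y in its H_k-orbit.

    A difference y - z of conjugates divides the discriminant, which is a
    monomial times a unit, so it is itself a monomial times a unit
    (root_diff_dom), and the condition on the support of y forces the monomial
    to be t^(m_j), where j is the first index such that the group element
    moves t^(m_j) (contact_dom).  Summing these contacts over G gives
    |H_k| r_k once every contact is truncated at m_k (rseq_level_sum).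

    Let eta be y with its coefficient at t^(m_k) replaced by an indeterminate
    U.  For P in R[Y], the initial coefficient of P(eta) is a polynomial in U,
    and the whole proof is a comparison of degrees in U.  Put N = n / d.

    - If deg P < N, the initial coefficient of P(eta) is a constant
      (low_degree).  Let z_0 be the H_k-invariant part of y.  It has N
      conjugates, at which P takes values that are conjugate and so have the
      same exponent; in Lagrange's formula the term of the conjugate closest
      to eta dominates, and its Lagrange polynomial has a constant initial
      coefficient.  Dividing repeatedly by a polynomial g of degree N with
      initial coefficient kappa U, it follows that a P of degree less than j N
      has an initial coefficient of degree less than j in U
      (semiroot_degree).

    - Call g a semiroot if g(eta) has initial term kappa U t^(r_k) with kappa
      nonzero.  The minimal polynomial of z_0 is one (base_semiroot).

    - The initial term of f(eta) is, up to a constant, t^(d r_k) times a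
      product of factors U - c w^(m_k) with w in H_k.  Its coefficient of
      U^(d-1) vanishes, because a nontrivial character of H_k has sum zero
      (ev_root_poly).

    Now write f = g^d + q g^(d-1) + r with g a semiroot of degree N and
    deg r < N (d-1).  The coefficient of U^(d-1) isolates the middle term, and
    its vanishing forces the exponent of q(eta) to be larger than r_k
    (quotient_val).  Hence g + q/d is again a semiroot, and it is a better
    approximation of f^(1/d).  After at most N such Tschirnhausen steps one
    reaches the approximate root App_d(f), which is therefore a semiroot
    (approximate_root).  Setting U equal to the coefficient of t^(m_k) in y,
    which is nonzero, gives O(f, App_d(f)) = r_k. *)

(** * Coefficients of products of series *)

Section Products.
Variables (R : comNzRingType) (e : nat).
Implicit Types (u v w : mseries R e) (p q m : 'X_{1..e}).

Lemma scoef0 m : (0 : mseries R e) m = 0. Proof. by []. Qed.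
Lemma scoefD u v m : (u + v) m = u m + v m. Proof. by []. Qed.
Lemma scoefB u v m : (u - v) m = u m - v m. Proof. by []. Qed.
Lemma scoef1 m : (1 : mseries R e) m = (m == 0%MM)%:R. Proof. by []. Qed.
Lemma scoefMn u m k : (u *+ k) m = u m *+ k.
Proof. by elim: k => // k IH; rewrite !mulrS scoefD IH. Qed.

Lemma scoef_sum (I : Type) (r : seq I) (P : pred I) (F : I -> mseries R e) m :
  (\sum_(i <- r | P i) F i) m = \sum_(i <- r | P i) F i m.
Proof. by elim/big_rec2: _ => // i a u _ <-. Qed.

Lemma supp_mul u v m : (u * v) m != 0 ->
  exists p q, [/\ m = (p + q)%MM, u p != 0 & v q != 0].
Proof.
move=> uv; apply: contrapT => nex; case/eqP: uv.
apply: big1 => -[k l] /= /eqP mE; apply/eqP; apply: contrapT => /negP.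
move=> kl.
case: (eqVneq (u k) 0) kl => [->|uk]; first by rewrite mul0r eqxx.
case: (eqVneq (v l) 0) => [->|vl]; first by rewrite mulr0 eqxx.
by move=> _; apply: nex; exists k, l.
Qed.

(** A coefficient of a product as a sum over any list of exponents that covers
    the support of the first factor: the summation index of the product of
    series carries degree bounds, which reindexings do not respect. *)
Lemma coef_mul_seq u v m (S : seq 'X_{1..e}) : uniq S ->
  (forall k, k \in S -> (k <= m)%MM) ->
  (forall k, (k <= m)%MM -> u k != 0 -> k \in S) ->
  (u * v) m = \sum_(k <- S) u k * v (m - k)%MM.
Proof.
move=> uS Sm mS.
pose d := (mdeg m).+1.
have lemd (k : 'X_{1..e}) : (k <= m)%MM -> (mdeg k < d)%N.
  by move=> km; rewrite /d ltnS -(submK km) mdegD leq_addl.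
have -> : (u * v) m =
    \sum_(k : 'X_{1..e < d} | (k <= m)%MM) u k * v (m - k)%MM.
  rewrite [LHS]/= -(pair_big_dep xpredT
     (fun k l : 'X_{1..e < d} => m == (k + l)%MM)
     (fun k l => u (bmnm k) * v (bmnm l))) /=.
  rewrite (bigID (fun k : 'X_{1..e < d} => (k <= m)%MM)) /= addrC big1 ?add0r.
    apply: eq_bigr => k km.
    have lm : (mdeg (m - k)%MM < d)%N by apply/lemd/lem_subr.
    rewrite (bigD1 (BMultinom lm)) /=; last by rewrite addmC submK.
    rewrite big1 ?addr0 // => l /andP[/eqP mE].
    by rewrite bmeqP /= {1}mE addmC addmK eqxx.
  by move=> k km; apply: big1 => l /eqP mE; rewrite mE lem_addr in km.
rewrite (bigID (fun k : 'X_{1..e < d} => bmnm k \in S)) /= addrC big1 ?add0r.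
  have -> : \sum_(k <- S) u k * v (m - k)%MM =
      \sum_(k <- pmap insub S : seq 'X_{1..e < d}) u k * v (m - k)%MM.
    rewrite -[S in LHS](_ : map val (pmap insub S : seq 'X_{1..e < d}) = _).
      by rewrite big_map.
    rewrite pmap_filter; last by move=> k; exact: insubK.
    apply/all_filterP/allP => k kS; rewrite isSome_insub.
    exact/lemd/Sm.
  rewrite [RHS]big_uniq ?pmap_sub_uniq //=; apply: eq_bigl => k.
  rewrite mem_pmap_sub; case kS: (_ \in S); rewrite ?andbT ?andbF //.
  exact: Sm.
move=> k /andP[km kS]; case: (eqVneq (u k) 0) => [->|uk]; first by rewrite mul0r.
by rewrite mS in kS.
Qed.

End Products.

(** * Initial terms for the degree-lexicographic order *)

Section ExpOrder.
Variable e : nat.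
Implicit Types p q r s : 'X_{1..e}.

(** The order for which the least exponent of the support is exp(u): total
    degree first, then the lexicographic order reversed, because exp takes the
    greatest exponent of the initial form. *)
Definition mle p q := (mdeg p < mdeg q)%N || (mdeg p == mdeg q) && (q <= p)%O.
Definition mlt p q := ~~ mle q p.

Lemma mle_refl p : mle p p.
Proof. by rewrite /mle eqxx lexx orbT. Qed.

Lemma mle_trans q p r : mle p q -> mle q r -> mle p r.
Proof.
rewrite /mle => /orP[pq|/andP[/eqP pq qp]] /orP[qr|/andP[/eqP qr rq]].
- by rewrite (ltn_trans pq qr).
- by rewrite -qr pq.
- by rewrite pq qr.
- by rewrite pq qr eqxx (le_trans rq qp) orbT.
Qed.

Lemma mle_anti p q : mle p q -> mle q p -> p = q.
Proof.
rewrite /mle => /orP[pq|/andP[/eqP pq qp]] /orP[qr|/andP[/eqP qr rq]]; try lia.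
by apply/eqP; rewrite eq_le rq qp.
Qed.

Lemma mle_total p q : mle p q || mle q p.
Proof.
rewrite /mle; case: (ltngtP (mdeg p) (mdeg q)) => //= _.
by rewrite orbC; exact: le_total.
Qed.

Lemma mltW p q : mlt p q -> mle p q.
Proof. by rewrite /mlt => /negPf h; have := mle_total p q; rewrite h orbF. Qed.

Lemma mlt_neqle p q : mlt p q = (p != q) && mle p q.
Proof.
apply/idP/andP => [pq|[npq pq]].
  by split; [apply: contraTneq pq => ->; rewrite /mlt mle_refl | exact: mltW].
by apply/negP => qp; case/eqP: npq; exact: mle_anti.
Qed.

Lemma mle_eqVlt p q : mle p q = (p == q) || mlt p q.
Proof.
by rewrite mlt_neqle; case: eqP => //= ->; rewrite mle_refl.
Qed.

Lemma mlt_le_trans q p r : mlt p q -> mle q r -> mlt p r.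
Proof. by move=> pq qr; apply: contra pq => rp; exact: mle_trans qr rp. Qed.

Lemma mle_add2r r p q : mle (p + r)%MM (q + r)%MM = mle p q.
Proof. by rewrite /mle !mdegD ltn_add2r eqn_add2r lemc_add2l. Qed.

Lemma mle_add p q r s : mle p q -> mle r s -> mle (p + r)%MM (q + s)%MM.
Proof.
move=> pq rs; apply: (@mle_trans (q + r)%MM); first by rewrite mle_add2r.
by rewrite addmC [(q + s)%MM]addmC mle_add2r.
Qed.

Lemma mlt_add2r r p q : mlt (p + r)%MM (q + r)%MM = mlt p q.
Proof. by rewrite /mlt mle_add2r. Qed.

Lemma mlt_add p q r s : mlt p q -> mle r s -> mlt (p + r)%MM (q + s)%MM.
Proof.
move=> pq rs; apply: (@mlt_le_trans (q + r)%MM); first by rewrite mlt_add2r.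
by rewrite mle_add ?mle_refl.
Qed.

Lemma lem_mle p q : (p <= q)%MM -> mle p q.
Proof.
move=> pq; rewrite -(submK pq); set r := (q - p)%MM.
rewrite /mle mdegD; case: (posnP (mdeg r)) => [/eqP|]; last by lia.
by rewrite mdeg_eq0 => /eqP ->; rewrite add0m mdeg0 eqxx lexx orbT.
Qed.

End ExpOrder.

(** The relation exp(u) = p; the initial coefficient is then u p. *)
Definition has_val (R : nmodType) e (u : mseries R e) p :=
  u p != 0 /\ forall q, u q != 0 -> mle p q.

Section Valuation.
Variables (R : idomainType) (e : nat).
Implicit Types (u v w : mseries R e) (p q m : 'X_{1..e}).

Lemma has_val_neq0 u p : has_val u p -> u != 0.
Proof. by case=> up _; apply: contraNneq up => ->. Qed.

Lemma has_val_inj u p q : has_val u p -> has_val u q -> p = q.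
Proof. by case=> up hp [uq hq]; apply: mle_anti; [apply: hp|apply: hq]. Qed.

(** Only finitely many exponents share the smallest total degree, so one of
    them is the greatest for the lexicographic order. *)
Lemma val_ex u : u != 0 -> exists p, has_val u p.
Proof.
move=> u0; have [m um] : exists m, u m != 0.
  by case: (smin_ex u0) => m um _; exists m.
have exd : exists d, `[< exists2 p, u p != 0 & mdeg p = d >].
  by exists (mdeg m); apply/asboolP; exists m.
case: (ex_minnP exd) => d /asboolP[p0 up0 dE] dmin.
have p0d : (mdeg p0 < d.+1)%N by rewrite dE.
pose P (k : 'X_{1..e < d.+1}) := u k != 0.
have P0 : P (BMultinom p0d) by [].
case: (@arg_maxP _ _ _ (BMultinom p0d) P (fun k => bmnm k) P0) => p up pmax.
exists p; split=> // q uq; rewrite /mle.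
have dp : (d <= mdeg p)%N by apply: dmin; apply/asboolP; exists p.
have dq : (d <= mdeg q)%N by apply: dmin; apply/asboolP; exists q.
have pd := bmdeg p.
case: (ltngtP (mdeg p) (mdeg q)) => //= [|pq]; first by lia.
have qd : (mdeg q < d.+1)%N by lia.
exact: (pmax (BMultinom qd)).
Qed.

Lemma coef_mul_val u v p q : (forall m, u m != 0 -> mle p m) ->
  (forall m, v m != 0 -> mle q m) -> (u * v) (p + q)%MM = u p * v q.
Proof.
move=> up vq.
have pd : (mdeg p < (mdeg (p + q)%MM).+1)%N by rewrite mdegD ltnS leq_addr.
have qd : (mdeg q < (mdeg (p + q)%MM).+1)%N by rewrite mdegD ltnS leq_addl.
rewrite [LHS]/= (bigD1 (BMultinom pd, BMultinom qd)) //= big1 ?addr0 //.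
case=> k l /= /andP[/eqP pqE kl].
case: (eqVneq (u k) 0) => [->|/up pk]; first by rewrite mul0r.
case: (eqVneq (v l) 0) => [->|/vq ql]; first by rewrite mulr0.
case/negP: kl; rewrite xpair_eqE !bmeqP /=.
move: pk; rewrite mle_eqVlt => /orP[/eqP pk|pk].
  rewrite -pk eqxx /= eq_sym; apply/eqP/(@addmI _ p).
    exact: etrans pqE (congr1 (fun x => x + l)%MM (esym pk)).
have := mlt_add pk ql; rewrite mlt_neqle => /andP[/eqP]; case; exact: pqE.
Qed.

Lemma val_mul u v p q : has_val u p -> has_val v q ->
  has_val (u * v) (p + q)%MM /\ (u * v) (p + q)%MM = u p * v q.
Proof.
case=> up hp [vq hq]; have E := coef_mul_val hp hq; split=> //; split.
  by rewrite E mulf_neq0.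
by move=> m /supp_mul[k [l [-> uk vl]]]; apply: mle_add; [apply: hp|apply: hq].
Qed.

Lemma val_one : has_val (1 : mseries R e) 0%MM.
Proof.
split=> [|q]; rewrite scoef1; first by rewrite eqxx oner_neq0.
by case: (eqVneq q 0%MM) => [->|]; rewrite ?mle_refl // eqxx.
Qed.

Lemma val_prod (I : Type) (r : seq I) (P : pred I) (F : I -> mseries R e)
    (V : I -> 'X_{1..e}) : (forall i, P i -> has_val (F i) (V i)) ->
  let p := (\big[+%MM/0%MM]_(i <- r | P i) V i) in
  has_val (\prod_(i <- r | P i) F i) p /\
  (\prod_(i <- r | P i) F i) p = \prod_(i <- r | P i) F i (V i).
Proof.
move=> FV p; rewrite {}/p.
elim: r => [|i r [IH1 IH2]].
  by rewrite !big_nil; split; [exact: val_one | rewrite scoef1 eqxx].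
rewrite !big_cons; case: ifP => // Pi.
by have [h1 h2] := val_mul (FV i Pi) IH1; split=> //; rewrite h2 IH2.
Qed.

Lemma val_exp u p k : has_val u p ->
  has_val (u ^+ k) (p *+ k)%MM /\ (u ^+ k) (p *+ k)%MM = u p ^+ k.
Proof.
move=> up; elim: k => [|k [IH1 IH2]].
  by rewrite !expr0; split; [exact: val_one | rewrite scoef1 mulm0n eqxx].
rewrite exprS mulmS.
by have [h1 h2] := val_mul up IH1; split=> //; rewrite h2 IH2 exprS.
Qed.

Lemma val_add u v p : has_val u p -> (forall q, v q != 0 -> mlt p q) ->
  has_val (u + v) p /\ (u + v) p = u p.
Proof.
case=> up hp hv; have vp : v p = 0.
  by apply/eqP; apply: contraT => /hv; rewrite /mlt mle_refl.
have E : (u + v) p = u p by rewrite scoefD vp addr0.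
split=> //; split; first by rewrite E.
move=> q; rewrite scoefD; case: (eqVneq (u q) 0) => [->|/hp //].
by rewrite add0r => /hv/mltW.
Qed.

Lemma val_gt u p q : has_val u p -> mlt q p -> u q = 0.
Proof.
case=> _ hp qp; apply/eqP; apply: contraT => /hp.
by rewrite (negPf qp).
Qed.

End Valuation.

(** * Monomials times units *)

(** Over a field this says that u is t^p times a unit. *)
Definition has_dom (R : nmodType) e (u : mseries R e) p :=
  u p != 0 /\ forall q, u q != 0 -> (p <= q)%MM.

Lemma has_dom_val (R : nmodType) e (u : mseries R e) p : has_dom u p -> has_val u p.
Proof. by case=> up h; split=> // q /h; exact: lem_mle. Qed.

Section Dominant.
Variables (R : idomainType) (e : nat).
Implicit Types (u v w : mseries R e) (p q m : 'X_{1..e}).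

Definition slice (i : 'I_e) a u : mseries R e :=
  MSeries (fun p => if p i == a then u p else 0).

Definition coord_min (i : 'I_e) u a :=
  (exists2 p, u p != 0 & p i = a) /\ forall p, u p != 0 -> (a <= p i)%N.

Lemma coord_min_ex i u : u != 0 -> exists a, coord_min i u a.
Proof.
case/val_ex => p [up _].
have exa : exists a, `[< exists2 p, u p != 0 & p i = a >].
  by exists (p i); apply/asboolP; exists p.
case: (ex_minnP exa) => a /asboolP h amin; exists a; split=> // q uq.
by apply: amin; apply/asboolP; exists q.
Qed.

(** The slices where the i-th coordinate is minimal multiply like initial
    forms: their product is nonzero because series form a domain, and it is the
    corresponding slice of the product. *)
Lemma coord_min_mul i u v a b : coord_min i u a -> coord_min i v b ->
  exists2 m, (u * v) m != 0 & m i = (a + b)%N.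
Proof.
case=> -[p up pa] ua [[q vq qb] vb].
have su : slice i a u != 0.
  apply: contraNneq up => /(congr1 (fun w : mseries R e => w p)) /=.
  by rewrite pa eqxx => ->.
have sv : slice i b v != 0.
  apply: contraNneq vq => /(congr1 (fun w : mseries R e => w q)) /=.
  by rewrite qb eqxx => ->.
case/val_ex: (mulf_neq0 su sv) => m [uvm _].
have mi : m i = (a + b)%N.
  case/supp_mul: (uvm) => k [l [-> /=]].
  case: (k i =P a) => [ka _|]; last by rewrite eqxx.
  by case: (l i =P b) => [lb _|]; [rewrite mnmDE ka lb | rewrite eqxx].
exists m => //; suff -> : (u * v) m = (slice i a u * slice i b v) m by [].
rewrite [LHS]/= [RHS]/=; apply: eq_bigr => -[k l] /= /eqP mE.
move: mi; rewrite {1}mE mnmDE => mi.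
case: (eqVneq (u k) 0) => [->|/ua ak]; first by rewrite if_same !mul0r.
case: (eqVneq (v l) 0) => [->|/vb bl]; first by rewrite if_same !mulr0.
by have [-> ->] : bmnm k i = a /\ bmnm l i = b by [lia]; rewrite !eqxx.
Qed.

(** The factors of a monomial times a unit have the same form.  The coordinate
    minima of the two supports add up to at most p, while p is a sum of one
    exponent of each support; so these two exponents attain all the minima. *)
Lemma dom_factor u v p : has_dom (u * v) p -> exists q, has_dom u q.
Proof.
case=> uvp hp.
have uv0 : u * v != 0 by apply: contraNneq uvp => ->.
have [u0 v0] : u != 0 /\ v != 0 by move: uv0; rewrite mulf_eq0 negb_or => /andP.
have /fin_all_exists[a ha] := fun i => coord_min_ex i u0.
have /fin_all_exists[b hb] := fun i => coord_min_ex i v0.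
have pE i : (p i <= a i + b i)%N.
  have [m uvm <-] := coord_min_mul (ha i) (hb i).
  by have /mnm_lepP := hp m uvm; apply.
have [k [l [pkl uk vl]]] := supp_mul uvp.
exists k; split=> // q uq; apply/mnm_lepP => i.
have [_ /(_ _ uq) aq] := ha i; have [_ /(_ _ vl) bl] := hb i.
by have := pE i; rewrite pkl mnmDE; lia.
Qed.

Lemma dom_smono N u : u 0%MM != 0 -> has_dom (smono R N * u) N.
Proof.
move=> u0; split=> [|q /supp_mul[k [l [-> /=]]]]; last first.
  by case: (k =P N) => [-> _ _|]; [exact: lem_addr | rewrite eqxx].
rewrite (@coef_mul_seq _ _ _ _ _ [:: N]) //=.
- rewrite big_seq1 /= eqxx mul1r; suff -> : (N - N = 0)%MM by [].
  by apply/mnmP => i; rewrite mnmBE subnn mnm0E.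
- by move=> k; rewrite inE => /eqP ->; exact: lepm_refl.
- by move=> k _; rewrite inE; case: (k =P N); rewrite ?eqxx.
Qed.

Lemma sunit_coef0 u : u \is a GRing.unit -> u 0%MM != 0.
Proof.
move=> uu.
have : ((u^-1 : mseries R e) * u) 0%MM != 0 by rewrite mulVr // scoef1 eqxx oner_neq0.
case/supp_mul => k [l [/esym/eqP]]; rewrite mnmD_eq0 => /andP[_ /eqP ->] _ //.
Qed.

End Dominant.

(** * Homomorphisms between rings of series *)

Section MapCoef.
Variables (R S : comNzRingType) (e : nat) (phi : {rmorphism R -> S}).

Definition smap (u : mseries R e) : mseries S e := MSeries (fun m => phi (u m)).

Fact smap_zmod_morphism : zmod_morphism smap.
Proof. by move=> u v; apply/mseriesP => m; rewrite /= rmorphD rmorphN. Qed.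

Fact smap_monoid_morphism : monoid_morphism smap.
Proof.
split=> [|u v]; apply/mseriesP => m; first by rewrite /= rmorph_nat.
by rewrite /= rmorph_sum; apply: eq_bigr => k _; rewrite rmorphM.
Qed.

HB.instance Definition _ :=
  GRing.isZmodMorphism.Build (mseries R e) (mseries S e) smap
    smap_zmod_morphism.
HB.instance Definition _ :=
  GRing.isMonoidMorphism.Build (mseries R e) (mseries S e) smap
    smap_monoid_morphism.

End MapCoef.

Section PowerSubst.
Variables (R : comNzRingType) (e n : nat).
Implicit Types (u v : mseries R e) (p m : 'X_{1..e}).

Lemma spow_mul u p : spow n.+1 u (p *+ n.+1)%MM = u p.
Proof.
rewrite /=; case: ifP => [_|/negbT/forallPn[i]]; last first.
  by rewrite mulmnE dvdn_mull.
by congr (u _); apply/mnmP => i; rewrite mnmE mulmnE mulnK.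
Qed.

Lemma spow_supp u m : spow n.+1 u m != 0 ->
  exists2 p, m = (p *+ n.+1)%MM & u p != 0.
Proof.
rewrite /=; case: ifP => [/forallP h|]; last by rewrite eqxx.
move=> up; exists [multinom (m i %/ n.+1)%N | i < e] => //.
by apply/mnmP => i; rewrite mulmnE mnmE divnK.
Qed.

Lemma spow_out u m : ~~ [forall i, n.+1 %| m i]%N -> spow n.+1 u m = 0.
Proof. by move=> /negPf h; rewrite /= h. Qed.

Lemma spow_inj : injective (@spow R e n.+1).
Proof. by move=> u v uv; apply/mseriesP => p; rewrite -(spow_mul u) -(spow_mul v) uv. Qed.

Fact spow_zmod_morphism : zmod_morphism (@spow R e n.+1).
Proof.
by move=> u v; apply/mseriesP => m /=; case: ifP; rewrite ?subr0.
Qed.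

Fact spow_monoid_morphism : monoid_morphism (@spow R e n.+1).
Proof.
split=> [|u v]; apply/mseriesP => m.
  case: (boolP [forall i, n.+1 %| m i]%N) => [/forallP h|h].
    have -> : m = ([multinom (m i %/ n.+1)%N | i < e] *+ n.+1)%MM.
      by apply/mnmP => i; rewrite mulmnE mnmE divnK.
    rewrite spow_mul !scoef1; congr (_ %:R); congr nat_of_bool.
    by rewrite -!mdeg_eq0 mdegMn muln_eq0 orbF.
  rewrite spow_out // scoef1; case: eqP => // m0; case/negP: h.
  by apply/forallP => i; rewrite m0 mnm0E dvdn0.
case: (boolP [forall i, n.+1 %| m i]%N) => [/forallP h|h]; last first.
  rewrite spow_out //; apply/esym/eqP; apply: contraT.
  case/supp_mul => k [l [mE /spow_supp[p kE _] /spow_supp[q lE _]]].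
  case/negP: h; apply/forallP => i.
  by rewrite mE kE lE mnmDE !mulmnE dvdn_add ?dvdn_mull.
have [p -> {m h}] : exists p, m = (p *+ n.+1)%MM.
  exists [multinom (m i %/ n.+1)%N | i < e].
  by apply/mnmP => i; rewrite mulmnE mnmE divnK.
pose S : seq 'X_{1..e} :=
  [seq k <- [seq bmnm k | k : 'X_{1..e < (mdeg p).+1}] | (k <= p)%MM].
have mS k : (k \in S) = (k <= p)%MM.
  rewrite mem_filter andbC; case kp: (k <= p)%MM; rewrite ?andbF ?andbT //.
  have kd : (mdeg k < (mdeg p).+1)%N by rewrite ltnS -(submK kp) mdegD leq_addl.
  by apply/mapP; exists (BMultinom kd); rewrite ?mem_enum.
have uS : uniq S.
  by rewrite filter_uniq // map_inj_uniq ?enum_uniq // => ? ? /val_inj.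
have mulI : injective (fun k : 'X_{1..e} => (k *+ n.+1)%MM).
  move=> k l /mnmP kl; apply/mnmP => i; have := kl i; rewrite !mulmnE => /eqP.
  by rewrite eqn_pmul2r // => /eqP.
have lemM k l : ((k *+ n.+1 <= l *+ n.+1) = (k <= l))%MM.
  apply/mnm_lepP/mnm_lepP => h i; have := h i; rewrite !mulmnE leq_pmul2r //.
rewrite spow_mul (@coef_mul_seq _ _ _ _ _ S) //; last 2 first.
- by move=> k; rewrite mS.
- by move=> k; rewrite mS.
rewrite (@coef_mul_seq _ _ _ _ _ [seq (k *+ n.+1)%MM | k <- S]).
- rewrite big_map; apply: eq_bigr => k _; rewrite !spow_mul; congr (_ * _).
  rewrite -(spow_mul v); congr (spow _ _ _); apply/mnmP => i.
  by rewrite mnmBE !mulmnE mnmBE mulnBl.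
- by rewrite map_inj_uniq.
- by move=> _ /mapP[k kS ->]; rewrite lemM -mS.
- by move=> _ /[swap] /spow_supp[k -> _]; rewrite lemM -mS => kS; exact: map_f.
Qed.

HB.instance Definition _ :=
  GRing.isZmodMorphism.Build (mseries R e) (mseries R e) (@spow R e n.+1)
    spow_zmod_morphism.
HB.instance Definition _ :=
  GRing.isMonoidMorphism.Build (mseries R e) (mseries R e) (@spow R e n.+1)
    spow_monoid_morphism.

End PowerSubst.

Lemma dom_spow (R : idomainType) e n (u : mseries R e) p :
  has_dom u p -> has_dom (spow n.+1 u) (p *+ n.+1)%MM.
Proof.
case=> up hp; split; first by rewrite spow_mul.
move=> _ /spow_supp[q -> /hp/mnm_lepP pq]; apply/mnm_lepP => i.
by rewrite !mulmnE leq_mul2r pq orbT.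
Qed.

(** * Roots of unity, interpolation and approximate roots *)

Lemma char0_natr_neq0 (K : fieldType) k :
  [pchar K] =i pred0 -> (0 < k)%N -> k%:R != 0 :> K.
Proof. by move/pcharf0P => -> ; rewrite -lt0n. Qed.

(** In characteristic 0 the polynomial X^n - 1 is coprime to its derivative,
    so it has n distinct roots. *)
Lemma prim_root_exists (K : closedFieldType) n :
  [pchar K] =i pred0 -> (0 < n)%N -> exists zeta : K, n.-primitive_root zeta.
Proof.
move=> charK n0.
have [r rE] := closed_field_poly_normal ('X^n - 1 : {poly K}).
rewrite (monicP (monicXnsubC 1 n0)) scale1r in rE.
have ur : uniq r.
  rewrite -separable_prod_XsubC -rE separable_poly.unlock.
  apply/Bezout_coprimepP; exists (- n%:R%:P, 'X); rewrite /= derivB derivXn derivC.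
  rewrite subr0 mulrnAr -exprS prednK // mulrBr mulNr mulr1 opprK.
  rewrite -['X^n *+ n]mulr_natl polyC_natr addrAC addNr add0r.
  by rewrite -polyC_natr polyC_eqp1 char0_natr_neq0.
have sr : size r = n.
  by have := size_XnsubC (1 : K) n0; rewrite rE size_prod_XsubC => -[].
have /hasP[z _ zP] : has n.-primitive_root r.
  apply: has_prim_root; rewrite ?sr //; apply/allP => z zr.
  by rewrite /root_of_unity rE root_prod_XsubC.
by exists z.
Qed.

(** The operator E k p = k p - X p' multiplies the coefficient of degree i by
    k - i, so it kills degree k and detects the next coefficient.  By the
    Leibniz rule E (s d) (P^s) = s P^(s-1) E d P, and degrees decide. *)
Lemma subleading_exp (K : fieldType) (P : {poly K}) d s :
  [pchar K] =i pred0 -> (0 < d)%N -> (0 < s)%N -> size P = d.+1 ->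
  (P ^+ s)`_(s * d).-1 = 0 -> P`_d.-1 = 0.
Proof.
move=> charK d0 s0 sP Q0; pose E k (p : {poly K}) := p *+ k - 'X * p^`().
have coefE k p i : (i <= k)%N -> (E k p)`_i = p`_i *+ (k - i).
  move=> ik; rewrite coefB coefMn coefXM; case: i ik => [|i] ik /=.
    by rewrite subr0 subn0.
  by rewrite coef_deriv mulrnBr.
have sE k (p : {poly K}) : (size p <= k.+1)%N -> (size (E k p) <= k)%N.
  move=> pk; apply/leq_sizeP => i; rewrite leq_eqVlt => /orP[/eqP <-|ki].
    by rewrite coefE // subnn mulr0n.
  rewrite coefB coefMn coefXM; case: i ki => [//|i] ki /=.
  by rewrite coef_deriv nth_default ?mul0rn ?subrr // (leq_trans pk).
have EP : E (s * d)%N (P ^+ s) = (P ^+ s.-1 * E d P) *+ s.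
  rewrite /E deriv_exp mulrBr mulrnBl; congr (_ - _).
    by rewrite mulrnAr -exprSr prednK // -mulrnA mulnC.
  by rewrite mulrnAr mulrA mulrC.
have P0 : P != 0 by rewrite -size_poly_eq0 sP.
apply/eqP; apply: contraT => Pd.
have sEP : size (E d P) = d.
  apply/eqP; rewrite eqn_leq sE ?sP //=.
  rewrite -{1}(prednK d0) ltnNge; apply: contra Pd => /leq_sizeP/(_ _ (leqnn _)).
  by rewrite coefE ?leq_pred // (_ : d - d.-1 = 1)%N; [rewrite mulr1n => -> | lia].
have EP0 : E d P != 0 by rewrite -size_poly_eq0 sEP -lt0n.
have sX : (size (P ^+ s.-1)).-1 = (d * s.-1)%N by rewrite size_exp sP.
have X0 : (0 < size (P ^+ s.-1))%N by rewrite size_poly_gt0 expf_neq0.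
have : (size (E (s * d)%N (P ^+ s)) <= (s * d).-1)%N.
  apply/leq_sizeP => i; rewrite leq_eqVlt => /orP[/eqP <-|].
    by rewrite coefE ?leq_pred // Q0 mul0rn.
  rewrite prednK ?muln_gt0 ?s0 // => si; apply/leq_sizeP: si; apply: sE.
  have := size_exp P s; rewrite sP /= => h.
  by rewrite -[size _]prednK ?h 1?mulnC // size_poly_gt0 expf_neq0.
rewrite EP -mulr_natr -polyC_natr [_ * _%:P]mulrC size_Cmul ?char0_natr_neq0 //.
rewrite size_mul ?expf_neq0 // sEP -(prednK X0) sX.
case: s {Q0 EP} s0 sX X0 => // s _ _ _; rewrite mulSn /= mulnC; lia.
Qed.

(** Lagrange's formula with its denominators D z cleared, to be valid over a
    domain. *)
Lemma lagrange_interpolation (A : idomainType) (O : seq A) (p : {poly A}) :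
  uniq O -> (size p <= size O)%N ->
  let L z := \prod_(x <- O | x != z) ('X - x%:P) in
  let D z := \prod_(x <- O | x != z) (z - x) in
  p * (\prod_(z <- O) D z)%:P =
  \sum_(z <- O) (p.[z] * \prod_(x <- O | x != z) D x)%:P * L z.
Proof.
move=> uO sp L D; apply/eqP; rewrite -subr_eq0; set q := _ - _.
have LD z : (L z).[z] = D z.
  by rewrite horner_prod; apply: eq_bigr => x _; rewrite hornerXsubC.
have L0 x z : x \in O -> x != z -> (L z).[x] = 0.
  by move=> xO xz; rewrite horner_prod (big_rem x) //= xz hornerXsubC subrr mul0r.
have sL z : z \in O -> size (L z) = size O.
  move=> zO; rewrite /L -big_filter size_prod_XsubC size_filter.
  rewrite -(count_predC (pred1 z) O) count_uniq_mem // zO add1n; congr _.+1.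
have sq : (size q <= size O)%N.
  apply: leq_trans (size_polyD _ _) _; rewrite geq_max size_polyN; apply/andP; split.
    by rewrite mulrC mul_polyC (leq_trans (size_scale_leq _ _)).
  apply: leq_trans (size_sum _ _ _) _; rewrite big_seq; elim/big_rec: _ => // z k zO kO.
  by rewrite geq_max kO mul_polyC (leq_trans (size_scale_leq _ _)) // sL.
apply: contraTT sq => q0; rewrite -ltnNge; apply: max_poly_roots => //.
apply/allP => z zO; apply/rootP.
rewrite hornerD hornerN hornerM hornerC horner_sum [X in _ - X](bigD1_seq z) //=.
rewrite [X in _ - (_ + X)]big_seq_cond [X in _ - (_ + X)]big1 ?addr0 => [|x /andP[xO xz]]; last first.
  by rewrite hornerM L0 ?mulr0 // eq_sym.
by rewrite hornerM hornerC LD (bigD1_seq z) //= mulrAC mulrA subrr.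
Qed.

Section AppRoot.
Variables (A : idomainType) (d : nat) (f : {poly A}).
Hypothesis d0 : d%:R != 0 :> A.

(** g^d - g'^d is g - g' times a sum of d monic polynomials of the same
    degree; as d is nonzero, the degree of the product is too large unless
    g = g'. *)
Lemma app_root_unique n N g g' : size f = n.+1 -> n = (N * d)%N ->
  is_app_root d f g -> is_app_root d f g' -> g = g'.
Proof.
move=> sf nE; have dpos : (0 < d)%N by case: d d0 => //; rewrite eqxx.
rewrite /is_app_root sf /= nE mulnK // => -[gm sg fg] [gm' sg' fg'].
apply/eqP; rewrite -subr_eq0; apply: contraT => gg'.
pose S := \sum_(i < d) g ^+ (d.-1 - i) * g' ^+ i.
have sX (h : {poly A}) j : h \is monic -> size h = N.+1 -> size (h ^+ j) = (N * j).+1.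
  move=> hm sh; have := size_exp h j; rewrite sh /= => <-.
  by rewrite prednK // size_poly_gt0 expf_neq0 // monic_neq0.
have St i : (i < d)%N -> (g ^+ (d.-1 - i) * g' ^+ i)`_(N * d.-1) = 1.
  move=> id.
  have tm : g ^+ (d.-1 - i) * g' ^+ i \is monic by rewrite monicMl monic_exp.
  rewrite -[RHS](monicP tm) /lead_coef size_mul ?monic_neq0 ?monic_exp //.
  by rewrite !sX //= addnS /= -mulnDr subnK // -ltnS prednK.
have SN : S`_(N * d.-1) = d%:R.
  rewrite coef_sum; under eq_bigr => i _ do rewrite St //.
  by rewrite sumr_const card_ord.
have sS : (N * d.-1 < size S)%N.
  by rewrite ltnNge; apply: contra d0 => h; rewrite -SN nth_default.
have : (size (g ^+ d - g' ^+ d)%R <= N * d.-1)%N.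
  have -> : g ^+ d - g' ^+ d = (f - g' ^+ d) - (f - g ^+ d).
    by rewrite opprB [RHS]addrC addrA subrK.
  apply: leq_trans (size_polyD _ _) _; rewrite size_polyN geq_max.
  have -> : (N * d.-1 = N * d - N)%N by rewrite -subn1 mulnBr muln1.
  by rewrite fg fg'.
rewrite subrXX -/S size_mul //; last by rewrite -size_poly_gt0 (leq_trans _ sS).
have h : (0 < size (g - g')%R)%N by rewrite size_poly_gt0.
by rewrite -(prednK h) addSn /= leqNgt (leq_trans sS) ?leq_addl.
Qed.

Lemma app_root_eq n N g : size f = n.+1 -> n = (N * d)%N ->
  is_app_root d f g -> app_root d f = g.
Proof.
move=> sf nE gf; rewrite /app_root; case: pselect => [ex|[]]; last by exists g.
exact: app_root_unique sf nE (svalP (cid ex)) gf.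
Qed.

End AppRoot.

(** * Maximal minors and the Smith normal form *)

Section Minors.
Variables p q : nat.
Implicit Types (A : 'M[int]_(p, q)) (g : 'I_p -> 'I_q).

Lemma det_colsub_noninj A g : ~ injective g -> \det (colsub g A) = 0.
Proof.
move=> ninj; rewrite -det_tr.
have [i [j [ij gij]]] : exists i j, i != j /\ g i = g j.
  apply: contrapT => h; apply: ninj => i j gij; apply/eqP.
  by apply: contrapT => /negP ij; apply: h; exists i, j.
by apply: (determinant_alternate ij) => k; rewrite !mxE gij.
Qed.

(** An injective choice of columns is an increasing one up to a permutation, so
    the increasing choices give all minors up to sign. *)
Lemma increasing_factor g : injective g -> exists (h : {ffun 'I_p -> 'I_q}) (s : 'S_p),
  [forall i : 'I_p, forall j : 'I_p, (i < j)%N ==> (h i < h j)%N]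
  /\ forall i, g i = h (s i).
Proof.
move=> gI; pose S := [set g i | i : 'I_p].
have cS : #|S| = p by rewrite card_imset // card_ord.
have gS i : g i \in S by apply: imset_f.
pose c i := cast_ord (esym cS) i.
pose h := [ffun i : 'I_p => Order.enum_val (c i) : 'I_q].
pose t i := cast_ord cS (Order.enum_rank_in (gS i) (g i)).
have ht i : g i = h (t i).
  by rewrite ffunE /c /t cast_ordK Order.EnumVal.enum_rankK_in.
have tI : injective t by move=> i j tij; apply: gI; rewrite !ht tij.
exists h, (perm tI); split; last by move=> i; rewrite permE.
apply/forallP => i; apply/forallP => j; apply/implyP => ij.
rewrite !ffunE ltnNge; have := @Order.le_enum_val _ 'I_q le_total (mem S) (c j) (c i).
by rewrite !leEord => E; apply/negP => hji; move: ij; rewrite ltnNge -[(j <= i)%N]E hji.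
Qed.

Lemma gcd_minors_dvd A g : (gcd_minors A %| `|\det (colsub g A)|%N)%N.
Proof.
case: (pselect (injective g)) => [gI|/det_colsub_noninj ->]; last first.
  by rewrite dvdn0.
have [h [s [hP gh]]] := increasing_factor gI.
have -> : colsub g A = col_perm s (colsub h A).
  by apply/matrixP => i j; rewrite !mxE gh.
rewrite col_permE det_mulmx det_perm abszM abszX /= exp1n muln1.
by rewrite /gcd_minors (bigD1 h) //= dvdn_gcdl.
Qed.

(** Expanding the columns of A W by multilinearity writes the determinant as an
    integral combination of minors of A, a weak form of the Cauchy-Binet
    formula. *)
Lemma gcd_minors_dvd_det A (W : 'M[int]_(q, p)) :
  (gcd_minors A %| `|\det (A *m W)|%N)%N.
Proof.
suff -> : \det (A *m W) =
    \sum_(g : {ffun 'I_p -> 'I_q}) (\prod_i W (g i) i) * \det (colsub g A).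
  apply: (big_ind (fun z : int => (gcd_minors A %| `|z|)%N)).
  - by rewrite dvdn0.
  - move=> x z hx hz; suff : ((gcd_minors A)%:Z %| x + z)%Z by rewrite dvdzE.
    by rewrite rpredD // dvdzE.
  - by move=> g _; rewrite abszM dvdn_mull // gcd_minors_dvd.
rewrite -det_tr {1}/determinant.
transitivity (\sum_(s : 'S_p) \sum_(g : {ffun 'I_p -> 'I_q})
   (-1) ^+ s * \prod_i (A (s i) (g i) * W (g i) i)).
  apply: eq_bigr => s _; rewrite -big_distrr /=; congr (_ * _).
  rewrite -(bigA_distr_bigA (fun i j => A (s i) j * W j i)).
  by apply: eq_bigr => i _; rewrite !mxE.
rewrite exchange_big; apply: eq_bigr => g _ /=.
rewrite -[\det (colsub g A)]det_tr /determinant big_distrr; apply: eq_bigr => s _ /=.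
rewrite big_split /= mulrA mulrC; congr (_ * (_ * _)).
by apply: eq_bigr => i _; rewrite !mxE.
Qed.

Lemma dvd_gcd_minors A z :
  (forall g, (z %| `|\det (colsub g A)|%N)%N) -> (z %| gcd_minors A)%N.
Proof.
move=> h; apply: (big_ind (fun x => (z %| x)%N)) => //.
by move=> x y; rewrite dvdn_gcd => -> ->.
Qed.

End Minors.

(** The Smith normal form, with the diagonal factor separated from a matrix W
    that has a right inverse.  The block n I forces the invariant factors to
    divide n. *)
Lemma char_mx_smith e n m i : (0 < n)%N ->
  exists (L : 'M[int]_e) (d : 'rV[int]_e) (W : 'M[int]_(e, e + i))
         (V : 'M[int]_(e + i, e)),
  [/\ L \in unitmx, char_mx n m i = L *m diag_mx d *m W, W *m V = 1%:M
    & forall b, (`|d ord0 b| %| n)%N].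
Proof.
move=> n0; have [L uL [R uR [d _ ME]]] := int_Smith_normal_form (char_mx n m i).
pose E : 'M[int]_(e, e + i) := \matrix_(a, b) (val a == val b)%:R.
pose dd := \row_(b < e) d`_b.
have DE : \matrix_(a, b) (d`_a *+ (val a == val b)) = diag_mx dd *m E.
  by apply/matrixP => a b; rewrite mul_diag_mx !mxE mulr_natr.
have EE : E *m E^T = 1%:M.
  apply/matrixP => a b; rewrite !mxE (bigD1 (lshift i a)) //= !mxE /= eqxx mul1r.
  rewrite big1 ?addr0 => [|c ca].
    by rewrite eq_sym -val_eqE.
  rewrite !mxE; case: eqP => [ac|]; last by rewrite mul0r.
  by case/eqP: ca; apply: val_inj.
pose V := invmx R *m E^T.
have WV : (E *m R) *m V = 1%:M by rewrite /V mulmxA mulmxK // EE.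
have ME' : char_mx n m i = L *m diag_mx dd *m (E *m R).
  by rewrite ME DE !mulmxA.
exists L, dd, (E *m R), V; split=> // b.
pose P : 'M[int]_(e + i, e) := col_mx 1%:M 0.
have MP : char_mx n m i *m P = (n%:Z)%:M.
  by rewrite mul_row_col mulmx1 mulmx0 addr0.
have : diag_mx dd *m ((E *m R) *m P *m L) = (n%:Z)%:M.
  have := congr1 (fun X => invmx L *m X *m L) MP.
  rewrite /= ME' -!mulmxA mulKmx // => ->.
  by rewrite -scalar_mxC mulKmx.
move=> /matrixP/(_ b b); rewrite mul_diag_mx !mxE eqxx mulr1n => E1.
suff : (d`_b %| n%:Z)%Z by rewrite dvdzE.
by apply/dvdzP; eexists; rewrite mulrC; exact: esym E1.
Qed.

(** One divisibility reads the product of the invariant factors off every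
    minor; the other applies the expansion of minors to the right inverse of
    W. *)
Lemma gcd_minors_smith e q (M : 'M[int]_(e, q)) (L : 'M[int]_e) (d : 'rV[int]_e)
    (W : 'M[int]_(e, q)) (V : 'M[int]_(q, e)) :
  L \in unitmx -> M = L *m diag_mx d *m W -> W *m V = 1%:M ->
  gcd_minors M = (\prod_b `|d ord0 b|)%N.
Proof.
move=> uL ME WV.
have dL : `|\det L|%N = 1%N.
  by move: uL; rewrite unitmxE => /orP[] /eqP ->.
have dE : `|\det (diag_mx d)|%N = (\prod_b `|d ord0 b|)%N.
  by rewrite det_diag; elim/big_rec2: _ => //= b x y _ <-; rewrite abszM.
apply/eqP; rewrite eqn_dvd; apply/andP; split.
  have := gcd_minors_dvd_det M V.
  by rewrite {2}ME -mulmxA WV mulmx1 det_mulmx abszM dL mul1n dE.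
apply: dvd_gcd_minors => g; rewrite ME.
have -> : colsub g (L *m diag_mx d *m W) = L *m diag_mx d *m colsub g W.
  by apply/matrixP => a b; rewrite !mxE; apply: eq_bigr => c _; rewrite !mxE.
by rewrite !det_mulmx !abszM dE dL mul1n dvdn_mulr.
Qed.

(** * Characters of the group of n-th roots of unity *)

Section Pairing.
Variables (e n' : nat).
Notation n := n'.+2.
Notation G := 'rV['Z_n]_e.
Implicit Types (a : G) (p q : 'X_{1..e}).

(** The row a stands for the tuple (zeta^(a_1), ..., zeta^(a_e)) of roots of
    unity, which multiplies t^p by zeta to the power pairing a p. *)
Definition pairing a p : 'Z_n := \sum_i a 0 i * (p i)%:R.

Lemma pairingD a (b : G) p : pairing (a + b) p = pairing a p + pairing b p.
Proof. by rewrite -big_split; apply: eq_bigr => i _; rewrite mxE mulrDl. Qed.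

Lemma pairingDr a p q : pairing a (p + q)%MM = pairing a p + pairing a q.
Proof.
by rewrite -big_split; apply: eq_bigr => i _; rewrite mnmDE natrD mulrDr.
Qed.

Lemma pairing0 p : pairing 0 p = 0.
Proof. by apply: big1 => i _; rewrite mxE mul0r. Qed.

Lemma natZ_eq0 k : (k%:R == 0 :> 'Z_n) = (n %| k)%N.
Proof. by rewrite -val_eqE /= val_Zp_nat. Qed.

Lemma intZ_eq0 (z : int) : (z%:~R == 0 :> 'Z_n) = (n%:Z %| z)%Z.
Proof.
case: z => k; first by rewrite -pmulrn natZ_eq0 dvdzE.
by rewrite NegzE mulrNz oppr_eq0 -pmulrn natZ_eq0 dvdzE abszN.
Qed.

Lemma mul_absz_eq0 (x : 'Z_n) (z : int) :
  (x * z%:~R == 0) = (x * `|z|%N%:R == 0).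
Proof. by case: z => k //; rewrite NegzE mulrNz mulrN oppr_eq0 abszN. Qed.

Lemma pairing_delta i p : pairing (delta_mx 0 i) p = (p i)%:R.
Proof.
rewrite /pairing (bigD1 i) //= mxE !eqxx mul1r big1 ?addr0 // => j ji.
by rewrite mxE (negPf ji) andbF mul0r.
Qed.

Lemma card_ann (d : nat) : (d %| n)%N ->
  #|[set x : 'Z_n | x * d%:R == 0]| = d.
Proof.
move=> dn; have d0 : (0 < d)%N by apply: dvdn_gt0 dn.
pose c := (n %/ d)%N; have nE : (c * d)%N = n by rewrite divnK.
have c0 : (0 < c)%N by rewrite divn_gt0 // dvdn_leq.
have lt_n (k : 'I_d) : (k * c < n)%N by rewrite -nE mulnC ltn_pmul2l.
pose h (k : 'I_d) : 'Z_n := (k * c)%:R.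
have hv k : h k = (k * c)%N :> nat by rewrite val_Zp_nat // modn_small.
have hI : injective h.
  move=> k l /(congr1 val) /=; rewrite !hv => /eqP.
  by rewrite eqn_pmul2r // => /eqP/val_inj.
transitivity #|[set h k | k : 'I_d]|; last by rewrite card_imset ?card_ord.
apply: eq_card => x; rewrite inE -{1}[x]natr_Zp -natrM natZ_eq0.
rewrite -[X in dvdn X _]nE dvdn_pmul2r //; apply/idP/imsetP => [/dvdnP[k xE]|[k _ ->]]; last by rewrite hv dvdn_mull.
have kd : (k < d)%N.
  have := ltn_ord x; rewrite {1}/Zp_trunc /= xE -[_.+2]nE mulnC.
  by rewrite ltn_pmul2l.
by exists (Ordinal kd) => //; apply: val_inj; rewrite /= hv.
Qed.

Variable m : seq 'X_{1..e}.

Definition Hset i : {set G} := [set a | [forall j : 'I_i, pairing a (nth 0%MM m j) == 0]].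

Lemma HsetP i a : reflect (forall j, (j < i)%N -> pairing a (nth 0%MM m j) = 0) (a \in Hset i).
Proof.
rewrite inE; apply: (iffP forallP) => [h j ji|h j].
  by have /eqP := h (Ordinal ji).
by rewrite h.
Qed.

Lemma HsetE i a :
  (a \in Hset i) = (a *m map_mx intr (char_mx n m i) == 0).
Proof.
have pE j : (a *m map_mx intr (char_mx n m i)) 0 (rshift e j) = pairing a (nth 0%MM m j).
  by rewrite mxE; apply: eq_bigr => b _; rewrite mxE row_mxEr mxE.
apply/HsetP/eqP => [h|/rowP h j ji]; last first.
  by have := h (rshift e (Ordinal ji)); rewrite pE mxE.
apply/rowP => c; rewrite [RHS]mxE -[c]splitK; case: (split c) => j /=.
  rewrite mxE big1 // => b _; rewrite mxE row_mxEl mxE.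
  suff /eqP -> : (n%:Z *+ (b == j))%:~R == 0 :> 'Z_n by rewrite mulr0.
  by rewrite intZ_eq0 -mulr_natr dvdz_mulr.
by rewrite pE h.
Qed.

(** H_i is the kernel of a |-> a M modulo n, where M is the matrix
    (n I, m_0, ..., m_(i-1)).  In Smith form this kernel is a product of the
    annihilators of the invariant factors d_b in Z/n, and the one of d_b has
    d_b elements because d_b divides n. *)
Lemma card_Hset i : #|Hset i| = Dseq n m i.
Proof.
case: i => [|i].
  rewrite /= (_ : Hset 0 = setT) ?cardsT ?card_mx ?card_ord ?mul1n //.
  by apply/setP => a; rewrite in_setT; apply/HsetP.
rewrite [RHS]/=; set M := char_mx n m i.+1.
have [L [d [W [V [uL ME WV dn]]]]] := @char_mx_smith e n m i.+1 isT.
rewrite (gcd_minors_smith uL ME WV).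
have fM s t r (A : 'M_(s, t)) (B : 'M_(t, r)) : map_mx (intr : int -> 'Z_n) (A *m B) =
    map_mx intr A *m map_mx intr B by exact: map_mxM.
have uL' : map_mx (intr : int -> 'Z_n) L \in unitmx.
  by rewrite unitmxE det_map_mx rmorph_unit // -unitmxE.
have HE a : (a \in Hset i.+1) =
    [forall b, (a *m map_mx intr L) 0 b * (`|d ord0 b|)%N%:R == 0].
  rewrite HsetE ME !fM; apply/eqP/forallP => [h b|h].
    have : a *m (map_mx intr L *m map_mx intr (diag_mx d)) = 0.
      have := congr1 (mulmx^~ (map_mx intr V)) h; rewrite /= mul0mx -!mulmxA -fM WV.
      by rewrite map_mx1 mulmx1.
    rewrite mulmxA map_diag_mx mul_mx_diag => /rowP/(_ b) E1.
    rewrite [RHS]mxE mxE [X in _ * X]mxE in E1.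
    rewrite -mul_absz_eq0; apply/eqP; exact: E1.
  suff -> : a *m (map_mx intr L *m map_mx intr (diag_mx d) *m map_mx intr W) =
    (a *m map_mx intr L *m map_mx intr (diag_mx d)) *m map_mx intr W.
    rewrite (_ : _ *m map_mx intr (diag_mx d) = 0) ?mul0mx //.
    rewrite map_diag_mx mul_mx_diag; apply/rowP => b; rewrite [RHS]mxE mxE.
    apply/eqP; rewrite [X in _ * X]mxE; exact: etrans (mul_absz_eq0 _ _) (h b).
  by rewrite !mulmxA.
pose F (b : 'I_e) := [pred x : 'Z_n | x * (`|d ord0 b|)%N%:R == 0].
transitivity #|family F|; last first.
  rewrite card_family; rewrite foldrE big_map -big_enum /=.
  by apply: eq_bigr => b _; rewrite -[RHS](card_ann (dn b)); apply: eq_card => x; rewrite inE.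
pose h (a : G) : {ffun 'I_e -> 'Z_n} := [ffun b => (a *m map_mx intr L) 0 b].
have hI : injective h.
  move=> a a' /ffunP aa; suff : a *m map_mx intr L = a' *m map_mx intr L.
    exact: can_inj (mulmxK uL') _ _.
  by apply/rowP => c; have := aa c; rewrite !ffunE.
rewrite -(card_imset (mem (Hset i.+1)) hI); apply: eq_card => g.
apply/imsetP/familyP => [[a aH ->] b|gF].
  by rewrite ffunE inE; move: aH; rewrite HE => /forallP.
exists ((\row_b g b) *m invmx (map_mx intr L)).
  by rewrite HE mulmxKV //; apply/forallP => b; have := gF b; rewrite inE mxE.
by apply/ffunP => b; rewrite ffunE mulmxKV // mxE.
Qed.

(** Duality between the lattice and its annihilator: in Smith form
    M = L D W, a vector outside of the lattice has a coordinate, in the basis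
    given by L, that is not divisible by the invariant factor d_b, and n / d_b
    times the dual basis vector separates it. *)
Lemma Hset_separates k p : (k <= size m)%N ->
  ~ in_lattice n m (fun j => j < k)%N p ->
  exists2 a, a \in Hset k & pairing a p != 0.
Proof.
move=> km np.
have [L [d [W [V [uL ME WV dn]]]]] := @char_mx_smith e n m k isT.
pose P : 'cV[int]_e := \col_b (p b)%:Z.
pose u := invmx L *m P.
case: (pselect (forall b, (d ord0 b %| u b ord0)%Z)) => [du|].
  case: np; have PE : P = char_mx n m k *m (V *m \col_b (u b ord0 %/ d ord0 b)%Z).
    rewrite ME -mulmxA [W *m _]mulmxA WV mul1mx -mulmxA mul_diag_mx.
    rewrite (_ : \matrix_(_, _) _ = u); first by rewrite /u mulKVmx.
    apply/colP => b; rewrite mxE [X in _ * X]mxE mulrC; exact: divzK (du b).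
  set x := V *m _ in PE; rewrite -[x]vsubmxK mul_row_col mul_scalar_mx in PE.
  exists (fun b => usubmx x b 0).
  exists (fun j => if insub j is Some j' then dsubmx x j' 0 else 0) => b.
  have := congr1 (fun A : 'cV_e => A b 0) PE; rewrite !mxE => ->.
  congr (_ + _); rewrite big_mkord -(big_ord_widen _
     (fun j => (nth 0%MM m j b)%:Z * (if insub j is Some j' then dsubmx x j' 0 else 0)) km).
  by apply: eq_bigr => j _; rewrite valK [X in X * _]mxE.
move=> nd; have [b ub] : exists b, ~~ (d ord0 b %| u b ord0)%Z.
  by apply: contrapT => h; apply: nd => b; apply: contrapT => /negP ub; apply: h; exists b.
pose c := (n%:Z %/ d ord0 b)%Z.
have nE : n%:Z = c * d ord0 b by rewrite divzK // dvdzE.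
pose A : 'rV[int]_e := c *: row b (invmx L).
have AP : (A *m P) 0 0 = c * u b ord0.
  by rewrite -scalemxAl -row_mul !mxE.
have prA q : pairing (map_mx intr A) q = ((A *m \col_b (q b)%:Z) 0 0)%:~R.
  by rewrite mxE rmorph_sum /pairing; apply: eq_bigr => i _; rewrite !mxE rmorphM.
exists (map_mx intr A).
  rewrite HsetE -map_mxM; apply/eqP/rowP => j; rewrite mxE [RHS]mxE; apply/eqP.
  rewrite intZ_eq0 ME -scalemxAl -row_mul mulmxA mulKmx // row_mul.
  rewrite mxE row_diag_mx -scalemxAl mxE mulrA -nE; exact: dvdz_mulr.
rewrite prA AP intZ_eq0; apply: contra ub.
rewrite nE [c * d _ _]mulrC [c * u _ _]mulrC dvdz_mul2r //.
by apply/eqP => c0; move: nE; rewrite c0 mul0r.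
Qed.

End Pairing.

(** * The sequence r_k as an average of contacts *)

Section Levels.
Variables (e n' : nat) (m : seq 'X_{1..e}).
Notation n := n'.+2.
Notation G := 'rV['Z_n]_e.
Notation H := (Hset n' m).

Lemma Hset0 k : 0 \in H k.
Proof. by apply/HsetP => j _; rewrite pairing0. Qed.

Lemma HsetD k a b : a \in H k -> b \in H k -> a + b \in H k.
Proof.
by move=> /HsetP ha /HsetP hb; apply/HsetP => j jk; rewrite pairingD ha ?hb ?addr0.
Qed.

Lemma Hset_sub j k : (j <= k)%N -> H k \subset H j.
Proof.
move=> jk; apply/subsetP => a /HsetP h; apply/HsetP => i ij.
by apply: h; apply: leq_trans jk.
Qed.

Lemma Hset_group_set k : group_set (H k).
Proof. by apply/group_setP; split=> [|a b]; [exact: Hset0 | exact: HsetD]. Qed.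

Canonical Hset_group k := Group (Hset_group_set k).

Lemma card_Hset_dvd j k : (j <= k)%N -> (#|H k| %| #|H j|)%N.
Proof. by move=> /Hset_sub/cardSg. Qed.

Lemma card_Hset_gt0 k : (0 < #|H k|)%N.
Proof. by apply/card_gt0P; exists 0; exact: Hset0. Qed.

(** The contact of y with its conjugate by a, truncated at m_k: the first
    m_j with j < k that a moves.  If there is none, find returns k, so the
    level is m_k. *)
Definition level k (a : G) : 'X_{1..e} :=
  nth 0%MM m (find (fun p => pairing a p != 0) (take k m)).

Lemma level_in k a : (k <= size m)%N -> a \in H k -> level k a = nth 0%MM m k.
Proof.
move=> km /HsetP aH; rewrite /level; congr (nth _ _ _).
rewrite hasNfind ?size_takel //.
apply/hasPn => p /(nthP 0%MM)[j]; rewrite size_takel // => jk <-.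
by rewrite nth_take // aH ?eqxx.
Qed.

Lemma notin_Hset_has k a : (k <= size m)%N -> a \notin H k ->
  has (fun p => pairing a p != 0) (take k m).
Proof.
move=> km; apply: contraNT => /hasPn h; apply/HsetP => j jk.
apply/eqP; have := h (nth 0%MM m j); rewrite negbK; apply.
by rewrite -(nth_take _ jk) mem_nth // size_takel.
Qed.

Lemma level_out k a : (k <= size m)%N -> a \notin H k -> exists j,
  [/\ (j < k)%N, level k a = nth 0%MM m j, forall i, (i < j)%N -> pairing a (nth 0%MM m i) = 0
    & pairing a (nth 0%MM m j) != 0].
Proof.
move=> km aH; have sk : size (take k m) = k by rewrite size_takel.
have hs := notin_Hset_has km aH.
have := hs; rewrite has_find sk => jk.
exists (find (fun p => pairing a p != 0) (take k m)); split=> //.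
  move=> i ij; have := before_find 0%MM ij; rewrite nth_take ?(ltn_trans ij) //.
  by move/negbFE/eqP.
by have := nth_find 0%MM hs; rewrite nth_take.
Qed.

Lemma levelS k a : (k < size m)%N ->
  level k.+1 a = if a \in H k.+1 then nth 0%MM m k.+1 else level k a.
Proof.
move=> km; case: ifP => [|/negbT aH]; first exact: level_in.
have hs := notin_Hset_has km aH; rewrite /level (take_nth 0%MM km) -cats1.
rewrite (take_nth 0%MM km) -cats1 has_cat in hs.
rewrite find_cat; case: ifP hs => //= hk; rewrite orbF => ->.
by rewrite addn0 [in RHS]hasNfind ?hk // size_takel // ltnW.
Qed.

Definition level_sum k : 'X_{1..e} := (\big[+%MM/0%MM]_(a : G) level k a).

Hypothesis m_le : forall i, (i.+1 < size m)%N -> (nth 0 m i <= nth 0 m i.+1)%MM.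

(** Passing from k to k+1 raises the level from m_k to m_(k+1) on H_(k+1) and
    nowhere else.  Divided by |H_(k+1)|, this is the recursion of r_k, since
    e_k is the index of H_(k+1) in H_k. *)
Lemma rseq_level_sum k : (k < size m)%N -> (rseq n m k *+ #|H k|)%MM = level_sum k.
Proof.
move=> km; apply/mnmP => i; rewrite mulmnE /level_sum mnm_sumE.
elim: k km => [|k IH] km.
  rewrite /= (eq_bigr (fun _ => nth 0%MM m 0 i)) => [|a _].
    rewrite sum_nat_const mulnC; congr (_ * _)%N; apply: eq_card => a.
    by transitivity true => //; apply/HsetP.
  by rewrite /level take0.
have km' := ltnW km; have {}IH := IH km'.
have eE : (eseq n m k * #|H k.+1| = #|H k|)%N.
  by rewrite /eseq -!card_Hset divnK // card_Hset_dvd.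
have le_i : (nth 0%MM m k i <= nth 0%MM m k.+1 i)%N by have /mnm_lepP := m_le km.
rewrite /= mnmDE mulmnE mnmBE mulnDl -mulnA eE IH mulnBl.
rewrite [in RHS](bigID (mem (H k.+1))) [in LHS](bigID (mem (H k.+1))) /=.
have E1 : (\sum_(a in H k.+1) level k a i = #|H k.+1| * nth 0%MM m k i)%N.
  rewrite -sum_nat_const; apply: eq_bigr => a aH.
  by rewrite level_in 1?ltnW //; apply: (subsetP (Hset_sub (leqnSn k))).
have E2 : (\sum_(a in H k.+1) level k.+1 a i = #|H k.+1| * nth 0%MM m k.+1 i)%N.
  by rewrite -sum_nat_const; apply: eq_bigr => a aH; rewrite levelS // aH.
have E3 : (\sum_(a | a \notin H k.+1) level k.+1 a i =
           \sum_(a | a \notin H k.+1) level k a i)%N.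
  by apply: eq_bigr => a /negPf aH; rewrite levelS // aH.
rewrite E1 E2 E3 ![(#|_| * _)%N]mulnC addnAC subnKC // leq_mul2r le_i orbT.
by [].
Qed.

End Levels.

(** * The action of roots of unity on series *)

Section Action.
Variables (K : fieldType) (e n' : nat) (zeta : K).
Notation n := n'.+2.
Hypothesis zetaP : n.-primitive_root zeta.
Notation G := 'rV['Z_n]_e.
Notation A := (mseries K e).
Implicit Types (a b c : G) (p q : 'X_{1..e}) (u v w z : A).

Definition chi a p : K := zeta ^+ (pairing a p : nat).

Lemma chi_add (x y : 'Z_n) : zeta ^+ (x + y)%R = zeta ^+ x * zeta ^+ y.
Proof. by rewrite -exprD /= -[RHS](prim_expr_mod zetaP). Qed.

Lemma chiD a b p : chi (a + b) p = chi a p * chi b p.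
Proof. by rewrite /chi pairingD chi_add. Qed.

Lemma chiDr a p q : chi a (p + q)%MM = chi a p * chi a q.
Proof. by rewrite /chi pairingDr chi_add. Qed.

Lemma chi_eq1 a p : (chi a p == 1) = (pairing a p == 0).
Proof.
rewrite /chi -(prim_order_dvd zetaP) -val_eqE /= /dvdn modn_small //.
Qed.

Lemma chi_neq0 a p : chi a p != 0.
Proof.
apply: expf_neq0; apply/eqP => z0; have := prim_expr_order zetaP.
by rewrite z0 expr0n => /eqP; rewrite eq_sym oner_eq0.
Qed.

Definition act a u : A := MSeries (fun p => chi a p * u p).

Lemma actE a u p : act a u p = chi a p * u p. Proof. by []. Qed.

Fact act_zmod_morphism a : zmod_morphism (act a).
Proof. by move=> u v; apply/mseriesP => p; rewrite /= mulrBr. Qed.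

Fact act_monoid_morphism a : monoid_morphism (act a).
Proof.
split=> [|u v]; apply/mseriesP => p.
  rewrite actE scoef1; case: eqP => [->|_]; rewrite ?mulr0 // mulr1.
  by apply/eqP; rewrite chi_eq1 /pairing big1 // => i _; rewrite mnm0E mulr0.
rewrite /= mulr_sumr; apply: eq_bigr => k /eqP pE.
by rewrite (congr1 (chi a) pE) chiDr mulrACA.
Qed.

HB.instance Definition _ a :=
  GRing.isZmodMorphism.Build A A (act a) (act_zmod_morphism a).
HB.instance Definition _ a :=
  GRing.isMonoidMorphism.Build A A (act a) (act_monoid_morphism a).

Lemma act_add a b u : act (a + b) u = act a (act b u).
Proof. by apply/mseriesP => p; rewrite !actE chiD mulrA. Qed.

Lemma act0 u : act 0 u = u.
Proof. by apply/mseriesP => p; rewrite actE /chi pairing0 expr0 mul1r. Qed.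

Lemma actK a : cancel (act a) (act (- a)).
Proof. by move=> u; rewrite -act_add addNr act0. Qed.

Lemma act_inj a : injective (act a). Proof. exact: can_inj (actK a). Qed.

Lemma act_supp a u p : (act a u p != 0) = (u p != 0).
Proof. by rewrite actE mulf_eq0 (negPf (chi_neq0 a p)). Qed.

Lemma act_val a u p : has_val u p -> has_val (act a u) p.
Proof. by case=> up h; split=> [|q]; rewrite act_supp //; exact: h. Qed.

Lemma act_fixP a u :
  reflect (forall p, u p != 0 -> pairing a p = 0) (act a u == u).
Proof.
apply: (iffP eqP) => [E p up|h].
  have := congr1 (fun v : A => v p) E; rewrite actE -[RHS]mul1r => /(mulIf up) E1.
  by apply/eqP; rewrite -chi_eq1 E1.
apply/mseriesP => p; rewrite actE; case: (eqVneq (u p) 0) => [->|/h up].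
  by rewrite mulr0.
by rewrite /chi up expr0 mul1r.
Qed.

Lemma act_spow a u : act a (spow n u) = spow n u.
Proof.
apply/eqP/act_fixP => p /spow_supp[q -> _]; apply: big1 => i _.
by rewrite mulmnE; apply/eqP; rewrite natrM mulrA mulrC (_ : n%:R = 0) ?mul0r //;
  apply/eqP; rewrite natZ_eq0.
Qed.

Definition unspow u : A := MSeries (fun p => u (p *+ n)%MM).

(** The tuples with one nontrivial component show that an exponent of the
    support of an invariant series is divisible by n in each coordinate. *)
Lemma unspowK u : (forall a, act a u = u) -> spow n (unspow u) = u.
Proof.
move=> inv; apply/mseriesP => p.
case: (boolP [forall i, n %| p i]%N) => [/forallP h|h].
  have -> : p = ([multinom (p i %/ n)%N | i < e] *+ n)%MM.
    by apply/mnmP => i; rewrite mulmnE mnmE divnK.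
  by rewrite spow_mul.
rewrite spow_out //; apply/esym/eqP; apply: contraNT h => up.
apply/forallP => i; have /eqP/act_fixP/(_ p up)/eqP := inv (delta_mx 0 i).
by rewrite pairing_delta natZ_eq0.
Qed.

(** * Conjugates and their minimal polynomials *)

(** The distinct conjugates, as a list without repetition: the type of series
    is not finite. *)
Definition conjs u : seq A := undup [seq act a u | a : G].

Definition stab u : {set G} := [set a | act a u == u].

Lemma conjs_uniq u : uniq (conjs u). Proof. exact: undup_uniq. Qed.

Lemma conjsP u z : reflect (exists a, z = act a u) (z \in conjs u).
Proof.
rewrite mem_undup; apply: (iffP mapP) => [[a _ ->]|[a ->]]; exists a => //.
by rewrite mem_enum.
Qed.

Lemma conjs_self u : u \in conjs u.
Proof. by apply/conjsP; exists 0; rewrite act0. Qed.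

Lemma conjs_act a u : act a u \in conjs u.
Proof. by apply/conjsP; exists a. Qed.

Lemma conjs_perm a u : perm_eq [seq act a z | z <- conjs u] (conjs u).
Proof.
apply: uniq_perm; rewrite ?conjs_uniq ?map_inj_uniq ?conjs_uniq //.
  exact: act_inj.
move=> z; apply/mapP/conjsP => [[_ /conjsP[b ->] ->]|[b ->]].
  by exists (a + b); rewrite act_add.
exists (act (- a + b) u); first exact: conjs_act.
by rewrite -act_add addrA addrN add0r.
Qed.

Lemma card_fiber u z : z \in conjs u -> #|[set a | act a u == z]| = #|stab u|.
Proof.
case/conjsP => b ->; rewrite -[RHS](card_imset _ (addrI b)); apply: eq_card => a.
rewrite inE; apply/eqP/imsetP => [E|[c]].
  by exists (- b + a); rewrite ?inE ?act_add ?E ?actK // addrA addrN add0r.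
by rewrite inE => /eqP cu ->; rewrite act_add cu.
Qed.

(** A product over the group counts each conjugate once for each element of
    the stabilizer. *)
Lemma prod_conjs (S : comNzRingType) (F : A -> S) u :
  \prod_(a : G) F (act a u) = (\prod_(z <- conjs u) F z) ^+ #|stab u|.
Proof.
transitivity (\prod_(z <- conjs u) \prod_(a | act a u == z) F z); last first.
  rewrite -prodrXl big_seq [RHS]big_seq; apply: eq_bigr => z zu.
  by rewrite prodr_const -(card_fiber zu) cardsE.
rewrite (exchange_big_dep xpredT) //=; apply: eq_bigr => a _.
rewrite -big_filter (eq_filter (a2 := pred1 (act a u))).
  by rewrite filter_pred1_uniq ?conjs_uniq ?conjs_act // big_seq1.
by move=> z; rewrite /= eq_sym.
Qed.

Lemma size_conjs u : (size (conjs u) * #|stab u|)%N = (n ^ e)%N.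
Proof.
have -> : (n ^ e)%N = #|G| by rewrite card_mx card_ord mul1n.
rewrite -[RHS]sum1_card -sum1_size big_distrl /=.
transitivity (\sum_(z <- conjs u) \sum_(a : G | act a u == z) 1)%N.
  rewrite big_seq [RHS]big_seq; apply: eq_bigr => z zu.
  by rewrite mul1n -(card_fiber zu) cardsE -sum1_card.
rewrite (exchange_big_dep xpredT) //=; apply: eq_bigr => a _.
rewrite -big_filter (eq_filter (a2 := pred1 (act a u))).
  by rewrite filter_pred1_uniq ?conjs_uniq ?conjs_act // big_seq1.
by move=> z; rewrite /= eq_sym.
Qed.

Notation phi := (map_poly (@spow K e n)).

Definition conjs_poly u : {poly A} := \prod_(z <- conjs u) ('X - z%:P).

(** The group permutes the factors, hence fixes the coefficients, which are
    then series in t^n. *)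
Lemma conjs_poly_descends u : exists2 P : {poly A}, phi P = conjs_poly u &
  P \is monic /\ size P = (size (conjs u)).+1.
Proof.
have inv a : map_poly (act a) (conjs_poly u) = conjs_poly u.
  rewrite rmorph_prod [RHS]/conjs_poly -[RHS](perm_big _ (conjs_perm a u)) big_map.
  by apply: eq_bigr => z _; rewrite /= map_polyXsubC.
pose P := \poly_(i < size (conjs_poly u)) unspow (conjs_poly u)`_i.
have PE : phi P = conjs_poly u.
  apply/polyP => i; rewrite coef_map coef_poly; case: ltnP => iu.
    rewrite /= unspowK // => a.
    by rewrite -[in RHS](inv a) coef_map.
  by rewrite /= raddf0 nth_default.
have sP : size P = size (phi P).
  by rewrite size_map_inj_poly ?rmorph0 //; exact: spow_inj.
exists P => //; split; last by rewrite sP PE size_prod_XsubC.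
apply/eqP/(@spow_inj _ _ n'.+1); rewrite /lead_coef -coef_map sP.
rewrite -/(lead_coef (phi P)) PE rmorph1; apply/eqP; exact: monic_prod_XsubC.
Qed.

Lemma horner_act (P : {poly A}) a z : (phi P).[act a z] = act a (phi P).[z].
Proof.
rewrite -horner_map -map_poly_comp; congr (_.[_]); apply/polyP => i.
by rewrite !coef_map /= act_spow.
Qed.

(** Divide f by the monic polynomial P over R that splits into the conjugates
    of y.  The remainder vanishes at all of them, hence is zero, and
    irreducibility makes the quotient a unit. *)
Lemma irreducible_conjs_poly (f : {poly A}) y : f \is monic ->
  irreducible_elt f -> subst_eval n f y = 0 -> phi f = conjs_poly y.
Proof.
move=> fm [_ _ firr] fy; have [P PE [Pm sP]] := conjs_poly_descends y.
have fE := Pdiv.RingMonic.rdivp_eq Pm f.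
set Q := Pdiv.Ring.rdivp f P in fE; set S := Pdiv.Ring.rmodp f P in fE.
have sS : (size S < size P)%N by rewrite Pdiv.Ring.ltn_rmodp monic_neq0.
have S0 : S = 0.
  apply/eqP; apply: contraLR sS => S0; rewrite -leqNgt sP.
  have iS : size (phi S) = size S.
    by rewrite size_map_inj_poly ?rmorph0 //; exact: spow_inj.
  rewrite -iS; apply: max_poly_roots; rewrite ?conjs_uniq //.
    by rewrite -size_poly_eq0 iS size_poly_eq0.
  apply/allP => _ /conjsP[a ->].
  have rP : root (phi P) (act a y) by rewrite PE root_prod_XsubC conjs_act.
  have := congr1 (fun g => (phi g).[act a y]) fE.
  rewrite /= rmorphD rmorphM /= hornerD hornerM (eqP rP) mulr0 add0r => E.
  by apply/rootP; rewrite -E horner_act -/(subst_eval n f y) fy rmorph0.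
rewrite S0 addr0 in fE.
case: (firr _ _ fE); rewrite poly_unitE => /andP[/size_poly1P[c c0 cE] _].
  rewrite -PE fE cE; congr map_poly; move: fm; rewrite fE cE mul_polyC.
  rewrite monicE lead_coefZ (eqP Pm) mulr1 => /eqP ->; exact: scale1r.
by have := conjs_self y; move: sP; rewrite cE size_polyC c0; case: (conjs y).
Qed.

End Action.

(** * Contact between conjugate roots *)

Section Contact.
Variables (K : fieldType) (e n' : nat) (zeta : K).
Notation n := n'.+2.
Hypothesis zetaP : n.-primitive_root zeta.
Notation G := 'rV['Z_n]_e.
Notation A := (mseries K e).
Notation act := (@act K e n' zeta).
Notation conjs := (@conjs K e n' zeta).
Notation stab := (@stab K e n' zeta).
Notation conjs_poly := (@conjs_poly K e n' zeta).
Notation phi := (map_poly (@spow K e n)).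
Hypothesis charK : [pchar K] =i pred0.

(** The discriminant lies in the ideal generated by f and f', so its value at y
    is a multiple of f'(y), and f'(y) is a multiple of y - z. *)
Lemma root_diff_dom (f : {poly A}) y z : f \is monic -> size f = n.+1 ->
  quasi_ordinary f -> phi f = conjs_poly y -> z \in conjs y -> z != y ->
  exists q, has_dom (y - z) q.
Proof.
move=> fm sf [N [u [uu fE]]] fy zy zny.
have sf' : (1 < size f^`())%N.
  have /eqP c1 : (f^`())`_n'.+1 != 0.
    rewrite coef_deriv (_ : f`_n'.+2 = 1); last by rewrite -(monicP fm) /lead_coef sf.
    apply: contraTneq (char0_natr_neq0 charK (ltn0Sn n'.+1)).
    move=> /(congr1 (fun w : A => w 0%MM)); rewrite scoefMn scoef1 eqxx scoef0.
    by move=> ->; rewrite eqxx.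
  by rewrite ltnNge; apply/negP => h; apply: c1; apply: nth_default; exact: leq_trans h _.
have sf1 : (1 < size f)%N by rewrite sf.
have [[U V] _ /= resE] := resultant_in_ideal sf1 sf'.
(* f (t^n, Y) = (Y - y) (Y - z) W, so that f'(y) = (y - z) W(y). *)
have [W WE] : exists W : {poly A}, phi f = ('X - y%:P) * (('X - z%:P) * W).
  rewrite fy /conjs_poly (big_rem _ (conjs_self n' zeta y)) /=.
  have zr : z \in rem y (conjs y) by rewrite mem_rem_uniq ?conjs_uniq // inE zny.
  by rewrite (big_rem _ zr) /=; eexists; reflexivity.
have fy0 : (phi f).[y] = 0 by rewrite WE hornerM hornerXsubC subrr mul0r.
have f'y : (phi f^`()).[y] = (y - z) * W.[y].
  rewrite -deriv_map WE derivM derivXsubC mul1r hornerD.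
  by rewrite [X in _ + X]hornerM hornerXsubC subrr mul0r addr0 hornerM hornerXsubC.
have resy : spow n (resultant f f^`()) = (phi V).[y] * ((y - z) * W.[y]).
  have := congr1 (fun g => (phi g).[y]) resE.
  rewrite /= map_polyC hornerC rmorphD !rmorphM /= hornerD !hornerM fy0 mulr0 add0r.
  by rewrite f'y.
have dE : spow n (discr f) =
    (y - z) * (W.[y] * ((phi V).[y] * spow n ((-1) ^+ 'C((size f).-1, 2)))).
  rewrite /discr rmorphM /= resy mulrC -mulrA mulrCA -!mulrA.
  by congr (_ * _); rewrite mulrCA.
apply: (@dom_factor _ _ _ (W.[y] * ((phi V).[y] * spow n ((-1) ^+ 'C((size f).-1, 2))))
  (N *+ n)%MM).
rewrite -dE fE; apply/dom_spow/dom_smono; exact: sunit_coef0.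
Qed.

Lemma in_lattice_pairing m (J : pred nat) (a : G) p : in_lattice n m J p ->
  (forall i, (i < size m)%N -> J i -> pairing a (nth 0%MM m i) = 0) -> pairing a p = 0.
Proof.
move=> [z [c pE]] h.
have E b : (p b)%:R = \sum_(i < size m | J i) (nth 0%MM m i b)%:R * (c i)%:~R :> 'Z_n.
  have := congr1 (fun x : int => x%:~R : 'Z_n) (pE b).
  rewrite /= -pmulrn rmorphD rmorphM /= (_ : n%:~R = 0); last first.
    by apply/eqP; rewrite intZ_eq0.
  rewrite mul0r add0r big_mkord => ->; rewrite rmorph_sum /=.
  by apply: eq_bigr => i _; rewrite rmorphM.
rewrite /pairing; under eq_bigr => b _ do rewrite E mulr_sumr.
rewrite exchange_big /=; apply: big1 => i Ji.
under eq_bigr => b _ do rewrite mulrA.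
by rewrite -mulr_suml -/(pairing a (nth 0%MM m i)) h // mul0r.
Qed.

Variables (y : A) (m : seq 'X_{1..e}).
Hypothesis m_char : char_exponents n y m.
Hypothesis y_dom : forall z, z \in conjs y -> z != y -> exists q, has_dom (y - z) q.

Lemma char_exp_neq0 i : (i < size m)%N -> y (nth 0%MM m i) != 0.
Proof. by case: m_char => h _ _ _; exact: h. Qed.

Lemma char_exp_le i j : (i <= j)%N -> (j < size m)%N -> (nth 0%MM m i <= nth 0%MM m j)%MM.
Proof.
rewrite leq_eqVlt => /orP[/eqP -> _|ij js]; first exact: lepm_refl.
by case: m_char => _ /(_ i j); rewrite ij js => /(_ isT)[].
Qed.

Lemma char_exp_neq i j : (i < j)%N -> (j < size m)%N -> nth 0%MM m i != nth 0%MM m j.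
Proof.
move=> ij js; apply/eqP.
by case: m_char => _ /(_ i j); rewrite ij js => /(_ isT)[].
Qed.

Lemma char_exp_mlt i j : (i < j)%N -> (j < size m)%N -> mlt (nth 0%MM m i) (nth 0%MM m j).
Proof.
by move=> ij js; rewrite mlt_neqle char_exp_neq //= lem_mle // char_exp_le // ltnW.
Qed.

Lemma supp_y_pairing (a : G) p : y p != 0 -> pairing a p != 0 ->
  exists i, [/\ (i < size m)%N, (mdeg (nth 0%MM m i) <= mdeg p)%N
    & pairing a (nth 0%MM m i) != 0].
Proof.
case: m_char => _ _ h _ yp ap; apply: contrapT => nex; case/eqP: ap.
apply: (in_lattice_pairing (h p yp)) => i im ip; apply/eqP; apply: contrapT => /negP ai.
by apply: nex; exists i.
Qed.

(** The dominating exponent q of y minus its conjugate is at most m_j.  The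
    group element moves t^q, so it moves some t^(m_i) with |m_i| <= |q|, and
    then i >= j; so |m_j| <= |q| and q = m_j. *)
Lemma contact_dom (a : G) j : (j < size m)%N ->
  (forall i, (i < j)%N -> pairing a (nth 0%MM m i) = 0) ->
  pairing a (nth 0%MM m j) != 0 ->
  forall p, y p != 0 -> pairing a p != 0 -> (nth 0%MM m j <= p)%MM.
Proof.
move=> jm ai aj.
have supp p : ((y - act a y) p != 0) = (y p != 0) && (pairing a p != 0).
  rewrite scoefB actE -[X in X - _]mul1r -mulrBl mulf_eq0 negb_or andbC.
  by rewrite subr_eq0 [1 == _]eq_sym (chi_eq1 zetaP).
have [|q [+ qmin]] := y_dom (conjs_act zeta a y).
  have := char_exp_neq0 jm; apply: contraNneq => ayy.
  have := supp (nth 0%MM m j); rewrite ayy subrr scoef0 eqxx aj andbT.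
  by move=> /esym/negbFE.
rewrite supp => /andP[yq aq].
suff -> : nth 0%MM m j = q.
  by move=> p yp ap; apply: qmin; rewrite supp yp ap.
have qj : (q <= nth 0%MM m j)%MM by apply: qmin; rewrite supp char_exp_neq0.
have [i [im iq aIi]] := supp_y_pairing yq aq.
have ji : (j <= i)%N by rewrite leqNgt; apply: contra aIi => /ai ->.
have : (mdeg (nth 0%MM m j) <= mdeg q)%N.
  by apply: leq_trans iq; rewrite -(submK (char_exp_le ji im)) mdegD leq_addl.
rewrite -(submK qj) mdegD -{2}[mdeg q]add0n leq_add2r leqn0 mdeg_eq0.
by move=> /eqP ->; rewrite add0m.
Qed.

Lemma supp_y_stable k p : (k < size m)%N -> y p != 0 ->
  (exists2 a : G, a \in Hset n' m k & pairing a p != 0) -> (nth 0%MM m k <= p)%MM.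
Proof.
move=> km yp [a /HsetP aH ap].
have [i0 [i0m _ ai0]] := supp_y_pairing yp ap.
have exi : exists i, (i < size m)%N && (pairing a (nth 0%MM m i) != 0).
  by exists i0; rewrite i0m.
case: (ex_minnP exi) => i /andP[im ai] imin.
apply: lepm_trans (contact_dom im _ ai yp ap); last first.
  move=> j ji; apply/eqP; apply: contraLR ji => aj; rewrite -leqNgt.
  by apply: imin; rewrite aj andbT; case: ltnP aj => // jm; rewrite nth_default // => /negP[];
     apply/eqP; apply: big1 => b _; rewrite mnm0E mulr0.
by apply: char_exp_le => //; rewrite leqNgt; apply: contra ai => /aH ->.
Qed.

(** The monomials of y lie in the lattice of the m_j, which themselves occur in
    y. *)
Lemma stab_y : stab y = Hset n' m (size m).
Proof.
apply/setP => a; rewrite inE; apply/(act_fixP zetaP)/HsetP => [h i im|h p yp].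
  exact/h/char_exp_neq0.
apply/eqP; apply: contraT => ap; have [i [im _]] := supp_y_pairing yp ap.
by rewrite h ?eqxx.
Qed.

End Contact.

(** * Semiroots and approximate roots *)

Section ApproximateRoots.
Variables (K : fieldType) (e n' : nat) (zeta : K).
Notation n := n'.+2.
Hypothesis zetaP : n.-primitive_root zeta.
Hypothesis charK : [pchar K] =i pred0.
Notation G := 'rV['Z_n]_e.
Notation A := (mseries K e).
Notation B := (mseries {poly K} e).
Notation act := (@act K e n' zeta).
Notation conjs := (@conjs K e n' zeta).
Notation stab := (@stab K e n' zeta).
Notation conjs_poly := (@conjs_poly K e n' zeta).
Notation phi := (map_poly (@spow K e n)).
Notation emb := (@smap K {poly K} e polyC).

Lemma emb_val (u : A) p : has_val u p -> has_val (emb u) p.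
Proof. by case=> up h; split=> [|q]; rewrite /= polyC_eq0 //; exact: h. Qed.

Variables (y : A) (m : seq 'X_{1..e}).
Hypothesis m_char : char_exponents n y m.
Hypothesis y_dom : forall z, z \in conjs y -> z != y -> exists q, has_dom (y - z) q.
Variable k : nat.
Hypothesis km : (k < size m)%N.
Notation mk := (nth 0%MM m k).
Notation Hk := (Hset n' m k).

(** The root y with its coefficient at m_k replaced by the indeterminate: a
    generic point of the set of series that agree with y below m_k. *)
Definition eta : B := MSeries (fun p => if p == mk then 'X else (y p)%:P).

Definition ev (P : {poly A}) : B := (map_poly emb (phi P)).[eta].

Fact ev_zmod_morphism : zmod_morphism ev.
Proof. by move=> P Q; rewrite /ev !rmorphB /= hornerD hornerN. Qed.

Fact ev_monoid_morphism : monoid_morphism ev.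
Proof.
by split=> [|P Q]; rewrite /ev ?rmorph1 ?hornerC // !rmorphM /= hornerM.
Qed.

HB.instance Definition _ :=
  GRing.isZmodMorphism.Build {poly A} B ev ev_zmod_morphism.
HB.instance Definition _ :=
  GRing.isMonoidMorphism.Build {poly A} B ev ev_monoid_morphism.

(** The part of y fixed by H_k; its conjugates are centers of the sets of
    conjugates of y that agree below m_k. *)
Definition center : A :=
  MSeries (fun p => if [forall a in Hk, pairing a p == 0] then y p else 0).

Notation level := (@level e n' m k).
Let km' := ltnW km.

Lemma level_out_lt a : a \notin Hk -> mlt (level a) mk.
Proof. by case/(level_out km') => j [jk -> _ _]; exact: (char_exp_mlt m_char jk km). Qed.

Lemma Hk_separated : exists2 a : G, a \in Hk & pairing a mk != 0.
Proof.
apply: Hset_separates; first exact: ltnW.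
by case: m_char => _ _ _; apply.
Qed.

Notation c := (y mk).
Lemma c_neq0 : c != 0. Proof. exact: (char_exp_neq0 m_char). Qed.

Lemma eta_sub p z : (eta - emb z) p =
  if p == mk then 'X - (z mk)%:P else (y p - z p)%:P.
Proof. by rewrite scoefB /=; case: eqP => [->|]; rewrite ?rmorphB. Qed.

Lemma inv_m i : (i < k)%N -> [forall a in Hk, pairing a (nth 0%MM m i) == 0].
Proof. by move=> ik; apply/forallP => a; apply/implyP => /HsetP ->. Qed.

Lemma not_inv_mk : [forall a in Hk, pairing a mk == 0] = false.
Proof.
apply/negbTE; case: Hk_separated => a aH am.
by apply/forallPn; exists a; rewrite negb_imply aH.
Qed.

Lemma not_inv_ge p : y p != 0 -> ~~ [forall a in Hk, pairing a p == 0] -> (mk <= p)%MM.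
Proof.
move=> yp /forallPn[a]; rewrite negb_imply => /andP[aH ap].
by apply: (supp_y_stable zetaP m_char y_dom km yp); exists a.
Qed.

(** The root y and its H_k-invariant part differ only at exponents that are
    at least m_k, so their conjugates have the same distance to eta, namely the level.  The
    indeterminate survives in the initial coefficient exactly on H_k. *)
Lemma conj_contact (z : A) (a : G) :
  (forall p, z p != y p -> (mk <= p)%MM) ->
  (forall i, (i < k)%N -> z (nth 0%MM m i) = y (nth 0%MM m i)) ->
  has_val (eta - emb (act a z)) (level a) /\
  (eta - emb (act a z)) (level a) =
    if a \in Hk then 'X - (chi zeta a mk * z mk)%:P
    else (y (level a) * (1 - chi zeta a (level a)))%:P.
Proof.
move=> zy zm; have coefE p : p != mk -> (eta - emb (act a z)) p = (y p - chi zeta a p * z p)%:P.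
  by move=> pm; rewrite eta_sub (negPf pm).
have supp p : p != mk -> (eta - emb (act a z)) p != 0 -> ~~ (mk <= p)%MM ->
    (y p != 0) && (pairing a p != 0).
  move=> pm; rewrite coefE // polyC_eq0 => h mp.
  have zp : z p = y p by apply/eqP; apply: contraNT mp; exact: zy.
  move: h; rewrite zp -[X in X - _]mul1r -mulrBl mulf_eq0 negb_or andbC.
  by rewrite subr_eq0 [1 == _]eq_sym (chi_eq1 zetaP).
have lead : (eta - emb (act a z)) (level a) =
    if a \in Hk then 'X - (chi zeta a mk * z mk)%:P
    else (y (level a) * (1 - chi zeta a (level a)))%:P.
  case: ifP => [aH|/negbT aH]; first by rewrite (level_in km') // eta_sub eqxx.
  have := level_out_lt aH; rewrite mlt_neqle => /andP[lm _].
  rewrite coefE //; case: (level_out km' aH) => j [jk -> _ _].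
  by rewrite zm // mulrBr mulr1 [chi _ _ _ * _]mulrC.
split=> //; apply: has_dom_val; split.
  rewrite lead; case: ifP => [_|/negbT aH]; first by rewrite polyXsubC_eq0.
  case: (level_out km' aH) => j [jk -> _ aj].
  rewrite polyC_eq0 mulf_neq0 ?(char_exp_neq0 m_char) //; first exact: ltn_trans km.
  by rewrite subr_eq0 eq_sym (chi_eq1 zetaP).
move=> p; case: (boolP (a \in Hk)) => [aH|aH].
  rewrite (level_in km') //; case: (eqVneq p mk) => [-> _|pm up]; first exact: lepm_refl.
  apply: contraT => mp; have /andP[yp ap] := supp p pm up mp.
  case/negP: mp; apply: not_inv_ge => //.
  by apply/forallPn; exists a; rewrite negb_imply aH.
case: (level_out km' aH) => j [jk lE ai aj] up.
have jmk : (level a <= mk)%MM by rewrite lE; apply: (char_exp_le m_char (ltnW jk) km).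
case: (boolP (mk <= p)%MM) => [|mp]; first exact: lepm_trans.
have pm : p != mk by apply: contraNneq mp => ->; exact: lepm_refl.
have /andP[yp ap] := supp p pm up mp; rewrite lE.
exact: (contact_dom zetaP m_char y_dom (ltn_trans jk km) ai aj yp ap).
Qed.

Lemma conj_root_contact a : has_val (eta - emb (act a y)) (level a) /\
  (eta - emb (act a y)) (level a) =
    if a \in Hk then 'X - (chi zeta a mk * c)%:P
    else (y (level a) * (1 - chi zeta a (level a)))%:P.
Proof. by apply: conj_contact => // p; rewrite eqxx. Qed.

Lemma conj_center_contact a : has_val (eta - emb (act a center)) (level a) /\
  (eta - emb (act a center)) (level a) =
    if a \in Hk then 'X
    else (y (level a) * (1 - chi zeta a (level a)))%:P.
Proof.
have [|i ik|h ->] := @conj_contact center a.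
- move=> p /=; case: ifP => [_|/negbT pi]; first by rewrite eqxx.
  by rewrite eq_sym => yp; exact: not_inv_ge.
- by rewrite /= inv_m.
by split=> //; rewrite /= not_inv_mk mulr0 subr0.
Qed.

Lemma level_lead_neq0 a : a \notin Hk ->
  y (level a) * (1 - chi zeta a (level a)) != 0.
Proof.
case/(level_out km') => j [jk -> _ aj].
rewrite mulf_neq0 ?(char_exp_neq0 m_char) //; first exact: ltn_trans km.
by rewrite subr_eq0 eq_sym (chi_eq1 zetaP).
Qed.

Lemma stab_center : stab center = Hk.
Proof.
apply/setP => a; rewrite inE; apply/(act_fixP zetaP)/HsetP => [h j jk|aH p /=].
  apply: h; rewrite /= inv_m //; apply: (char_exp_neq0 m_char); exact: ltn_trans km.
case: ifP => [/forallP/(_ a)|]; last by rewrite eqxx.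
by rewrite (introT (HsetP _ _ _) aH) => /eqP.
Qed.

Notation O := (conjs center).
Notation N := (size O).

Lemma ev_conjs_poly P u : phi P = conjs_poly u ->
  ev P = \prod_(z <- conjs u) (eta - emb z).
Proof.
rewrite /ev => ->; rewrite rmorph_prod /= horner_prod; apply: eq_bigr => z _.
by rewrite map_polyXsubC hornerXsubC.
Qed.

Lemma ev_conjs_poly_exp P u : phi P = conjs_poly u ->
  ev P ^+ #|stab u| = \prod_(a : G) (eta - emb (act a u)).
Proof. by move/ev_conjs_poly ->; rewrite (prod_conjs zetaP (fun z => eta - emb z)). Qed.

Lemma prod_const_lead : exists2 kappa : K, kappa != 0 &
  \prod_(a : G | a \notin Hk) (y (level a) * (1 - chi zeta a (level a)))%:P = kappa%:P.
Proof.
exists (\prod_(a : G | a \notin Hk) (y (level a) * (1 - chi zeta a (level a)))).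
  by apply/prodf_neq0 => a aH; exact: level_lead_neq0.
by rewrite rmorph_prod.
Qed.

Notation level_sum := (@level_sum e n' m k).

(** Exponents and initial coefficients are read off the product over the whole
    group, a power of P(eta), where each factor is known. *)
Lemma ev_conjs_poly_val P u (F : G -> {poly K}) : phi P = conjs_poly u -> P != 0 ->
  (forall a, has_val (eta - emb (act a u)) (level a) /\
    (eta - emb (act a u)) (level a) = if a \in Hk then F a
      else (y (level a) * (1 - chi zeta a (level a)))%:P) ->
  exists2 tau, has_val (ev P) tau & (tau *+ #|stab u|)%MM = level_sum /\
    exists2 kappa : K, kappa != 0 &
     (ev P) tau ^+ #|stab u| = kappa%:P * \prod_(a in Hk) F a.
Proof.
move=> PE P0 h.
have [V1 V2] := @val_prod _ _ _ (index_enum G) xpredT (fun a => eta - emb (act a u)) level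
  (fun a _ => (h a).1).
rewrite -(ev_conjs_poly_exp PE) in V1 V2.
have evP0 : ev P != 0.
  apply: contraTneq (has_val_neq0 V1) => ->.
  rewrite expr0n; case: (_ =P 0%N) => [s0|_]; last by rewrite eqxx.
  have := size_conjs zetaP u.
  by rewrite s0 muln0 => /esym/eqP; rewrite expn_eq0.
have [tau tauP] := val_ex evP0; exists tau => //.
have [W1 W2] := val_exp #|stab u| tauP.
have E := has_val_inj W1 V1; split=> //.
have [kappa k0 kE] := prod_const_lead; exists kappa => //.
rewrite -W2 E V2 (bigID (mem Hk)) /= mulrC -kE; congr (_ * _).
  by apply: eq_bigr => a /negPf aH; have := (h a).2; rewrite aH.
by apply: eq_bigr => a aH; have := (h a).2; rewrite aH.
Qed.

Notation rho := (rseq n m k).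

Lemma mulm_inj s : (0 < s)%N -> injective (fun p : 'X_{1..e} => p *+ s)%MM.
Proof.
move=> s0 p q /mnmP E; apply/mnmP => i; have := E i; rewrite !mulmnE => /eqP.
by rewrite eqn_pmul2r // => /eqP.
Qed.

Lemma rho_level_sum : (rho *+ #|Hk|)%MM = level_sum.
Proof.
by apply: rseq_level_sum => // i im; apply: (char_exp_le m_char).
Qed.

Definition semiroot (g : {poly A}) := has_val (ev g) rho /\
  exists2 kappa : K, kappa != 0 & (ev g) rho = kappa%:P * 'X.

Lemma base_semiroot : exists g0 : {poly A},
  [/\ phi g0 = conjs_poly center, g0 \is monic, size g0 = N.+1 & semiroot g0].
Proof.
have [g0 gE [gm sg]] := conjs_poly_descends zetaP center.
have [tau tauP [tE [kappa k0 kE]]] := ev_conjs_poly_val gE (monic_neq0 gm) conj_center_contact.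
exists g0; split=> //.
have tr : tau = rho.
  apply: (mulm_inj (card_Hset_gt0 n' m k)).
  by rewrite /= rho_level_sum -tE stab_center.
split; first by rewrite -tr.
rewrite -tr; move: kE; rewrite stab_center prodr_const; set P := ev g0 tau; set s := #|Hk| => kE.
have s0 : (0 < s)%N := card_Hset_gt0 n' m k.
have P0 : P != 0 by case: tauP.
have sP : size P = 2.
  have := size_exp P s; rewrite kE size_Cmul // size_polyXn /= => E.
  have /eqP : (s * 1 = s * (size P).-1)%N by rewrite muln1 {1}E mulnC.
  rewrite eqn_pmul2l // => /eqP E1.
  have P1 : (0 < size P)%N by rewrite size_poly_gt0.
  by rewrite -(prednK P1) -E1.
have P00 : P`_0 = 0.
  have : (P ^+ s).[0] = 0 by rewrite kE hornerM hornerXn expr0n gtn_eqF // mulr0.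
  rewrite horner_exp => /eqP; rewrite expf_eq0 s0 /= => /eqP.
  by rewrite horner_coef0.
exists P`_1; first by move: P0; rewrite -lead_coef_eq0 /lead_coef sP.
apply/polyP => i; rewrite coefCM coefX.
case: i => [|[|i]] /=; rewrite ?mulr0 ?mulr1 //.
by rewrite nth_default // sP.
Qed.

(** Translation by an element of H_k that moves t^(m_k) multiplies the sum by a
    number other than 1. *)
Lemma sum_chi : \sum_(a in Hk) chi zeta a mk = 0.
Proof.
have [b bH bm] := Hk_separated.
have E : \sum_(a in Hk) chi zeta a mk = chi zeta b mk * \sum_(a in Hk) chi zeta a mk.
  rewrite {1}(reindex_inj (addrI b)) /= mulr_sumr.
  rewrite (eq_bigl (mem Hk)) => [|a]; last first.
    by apply: (@groupMl _ (Hset_group n' m k)).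
  by apply: eq_bigr => a _; rewrite (chiD zetaP).
apply/eqP; move/eqP: E; rewrite -subr_eq0 -[X in X - _]mul1r -mulrBl mulf_eq0.
by rewrite subr_eq0 eq_sym (chi_eq1 zetaP) (negPf bm).
Qed.

(** The coefficient following the leading one is, up to a factor, the sum of
    the roots c w^(m_k), w in H_k, which is zero. *)
Lemma ev_root_poly f d : phi f = conjs_poly y -> f != 0 ->
  (d * #|stab y|)%N = #|Hk| ->
  has_val (ev f) (rho *+ d)%MM /\ ((ev f) (rho *+ d)%MM)`_d.-1 = 0.
Proof.
move=> fE f0 dE; set s := #|stab y| in dE.
have H0 := card_Hset_gt0 n' m k.
have s0 : (0 < s)%N by move: H0; rewrite -dE muln_gt0 => /andP[].
have d0 : (0 < d)%N by move: H0; rewrite -dE muln_gt0 => /andP[].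
have [tau tauP [tE [kappa k0 kE]]] := ev_conjs_poly_val fE f0 conj_root_contact.
have tr : tau = (rho *+ d)%MM.
  apply: (mulm_inj s0); rewrite tE -rho_level_sum -dE.
  by apply/mnmP => i; rewrite !mulmnE mulnA.
split; first by rewrite -tr.
rewrite -tr; set P := ev f tau in kE *.
have P0 : P != 0 by case: tauP.
pose r := [seq chi zeta a mk * c | a in Hk].
have rE : \prod_(a in Hk) ('X - (chi zeta a mk * c)%:P) = \prod_(x <- r) ('X - x%:P).
  by rewrite big_map big_enum.
have sr : size r = (s * d)%N by rewrite size_map -cardE mulnC.
have sP : size P = d.+1.
  have := size_exp P s; rewrite kE rE size_Cmul // size_prod_XsubC sr /= mulnC => /eqP.
  rewrite eqn_pmul2r // => /eqP ->; rewrite prednK // size_poly_gt0 //.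
apply: (subleading_exp charK d0 s0 sP); rewrite kE rE coefCM -sr.
rewrite coefPn_prod_XsubC ?sr -?lt0n ?muln_gt0 ?s0 //.
by rewrite big_map big_enum -mulr_suml sum_chi mul0r oppr0 mulr0.
Qed.

(** Write T z for the term of the conjugate z of the center in Lagrange's
    formula for P(eta).  The exponents of P(z) and of the denominator D z do
    not depend on z, as conjugation preserves exponents.  So the exponent of
    T z decreases as the level of z increases, and the term of the center
    itself dominates.  There T z times eta - z has an initial coefficient
    proportional to the indeterminate, and so does eta - z; so the one of T z
    is a constant. *)
Lemma low_degree (P : {poly A}) : P != 0 -> (size P <= N)%N ->
  exists2 tau, has_val (ev P) tau & size ((ev P) tau) = 1%N.
Proof.
move=> P0 sP; have [g0 [gE gm sg [gval [kappa k0 gl]]]] := base_semiroot.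
pose L z : {poly A} := \prod_(x <- O | x != z) ('X - x%:P).
pose D z := \prod_(x <- O | x != z) (z - x).
pose Q := phi P.
have sQ : size Q = size P.
  by rewrite size_map_inj_poly ?rmorph0 //; exact: spow_inj.
have sQN : (size Q <= N)%N by rewrite sQ.
have lag := lagrange_interpolation (conjs_uniq n' zeta center) sQN.
pose E (F : {poly A}) : B := (map_poly emb F).[eta].
pose D' z := \prod_(x <- O | x != z) D x.
pose T z := emb Q.[z] * emb (D' z) * E (L z).
have sumE : ev P * emb (\prod_(z <- O) D z) = \sum_(z <- O) T z.
  have := congr1 E lag; rewrite /E rmorphM hornerM /= map_polyC hornerC => ->.
  rewrite rmorph_sum horner_sum; apply: eq_bigr => z _.
  by rewrite rmorphM hornerM /= map_polyC hornerC /T -rmorphM.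
have TD z : z \in O -> T z * emb (D z) * (eta - emb z) =
    emb Q.[z] * emb (\prod_(x <- O) D x) * ev g0.
  move=> zO; have -> : ev g0 = E (L z) * (eta - emb z).
    rewrite (ev_conjs_poly gE) (bigD1_seq z) ?conjs_uniq //= mulrC; congr (_ * _).
    rewrite /E rmorph_prod horner_prod; apply: eq_bigr => x _.
    by rewrite /= map_polyXsubC hornerXsubC.
  rewrite (bigD1_seq z) ?conjs_uniq //= rmorphM /T /= -/(D' z).
  by rewrite [emb (D z) * _]mulrC !mulrA; congr (_ * _); rewrite -!mulrA [emb (D z) * _]mulrC.
have D0 z : D z != 0.
  rewrite /D prodf_seq_neq0; apply/allP => x _ /=; apply/implyP => xz.
  by rewrite subr_eq0 eq_sym.
have PD0 : \prod_(x <- O) D x != 0 by rewrite prodf_seq_neq0; apply/allP => x _ /=; exact: D0.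
have Dact a z : D (act a z) = act a (D z).
  rewrite /D rmorph_prod -(perm_big _ (conjs_perm zetaP a center)) big_map /=.
  apply: eq_big => [x|x _]; first by rewrite (inj_eq (@act_inj _ _ _ _ zetaP a)).
  by rewrite rmorphB.
have Qact a : Q.[act a center] = act a Q.[center] by exact: (horner_act zetaP).
have Qc0 : Q.[center] != 0.
  apply: contraTneq sQN => Qc; rewrite -ltnNge; apply: max_poly_roots; rewrite ?conjs_uniq //.
    by rewrite -size_poly_eq0 sQ size_poly_eq0.
  by apply/allP => _ /conjsP[a ->]; apply/rootP; rewrite Qact Qc rmorph0.
have [sig sigP] := val_ex (D0 center).
have [om omP] := val_ex Qc0.
have [pi piP] := val_ex PD0.
(* T z (D z) (eta - z) = P(z) (the product of all D x) g0(eta), where only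
   P(z) and D z depend on z and their exponents do not. *)
have tauE a t : has_val (T (act a center)) t ->
    (t + sig + level a = om + pi + rho)%MM /\
    T (act a center) t * (emb (D (act a center))) sig * (eta - emb (act a center)) (level a)
      = emb Q.[act a center] om * emb (\prod_(x <- O) D x) pi * ev g0 rho.
  move=> tP.
  have V1 : has_val (emb (D (act a center))) sig by rewrite Dact; exact/emb_val/act_val.
  have V2 : has_val (emb Q.[act a center]) om by rewrite Qact; exact/emb_val/act_val.
  have [W1 W2] := val_mul tP V1.
  have [X1 X2] := val_mul W1 (conj_center_contact a).1.
  have [Y1 Y2] := val_mul V2 (emb_val piP).
  have [Z1 Z2] := val_mul Y1 gval.
  have TDa := TD _ (conjs_act zeta a center).
  rewrite TDa in X1 X2; have tE := has_val_inj X1 Z1; split=> //.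
  by rewrite -W2 -X2 tE Z2 Y2.
have T0 z : z \in O -> T z != 0.
  case/conjsP => a ->.
  have h : emb Q.[act a center] * emb (\prod_(x <- O) D x) * ev g0 != 0.
    rewrite !mulf_neq0 ?(has_val_neq0 gval) ?(has_val_neq0 (emb_val piP)) //.
    by rewrite Qact; exact: (has_val_neq0 (emb_val (act_val zetaP a omP))).
  by apply: contraNneq h => Tz; rewrite -TD ?conjs_act // Tz !mul0r.
have [t0 t0P] := val_ex (T0 _ (conjs_self n' zeta center)).
have H0 : (0 : G) \in Hk by exact: Hset0.
have := tauE 0 t0; rewrite (act0 n' zeta center) => /(_ t0P)[t0E t0L].
rewrite (level_in km' H0) in t0E t0L.
(* The level of every other conjugate is smaller than m_k, so the exponent of
   its term is larger. *)
have others q : (\sum_(z <- O | z != center) T z) q != 0 -> mlt t0 q.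
  move=> hq; have [z [zO zc zq]] : exists z, [/\ z \in O, z != center & T z q != 0].
    apply: contrapT => nex; case/eqP: hq.
    rewrite scoef_sum big_seq_cond big1 // => z /andP[zO zc].
    by apply/eqP; apply: contrapT => /negP Tz; apply: nex; exists z.
  have [t tP] := val_ex (T0 z zO); apply: mlt_le_trans (tP.2 _ zq).
  case/conjsP: zO zc tP => a -> ac tP; have [tE _] := tauE a t tP.
  have aH : a \notin Hk.
    apply: contra ac => aH; apply/eqP.
    by move: aH; rewrite -stab_center inE => /eqP.
  apply/negP => tt0; have := mlt_add (level_out_lt aH) tt0.
  rewrite [(mk + t0)%MM]addmC [(level a + t)%MM]addmC -(mlt_add2r sig).
  rewrite -!addmA [(mk + sig)%MM]addmC [(level a + sig)%MM]addmC !addmA t0E tE.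
  by rewrite /mlt mle_refl.
have sumV : has_val (\sum_(z <- O) T z) t0 /\ (\sum_(z <- O) T z) t0 = T center t0.
  rewrite (bigD1_seq center) ?conjs_uniq ?conjs_self //=.
  exact: val_add.
have evP0 : ev P != 0.
  apply: contraTneq (has_val_neq0 sumV.1) => evP; rewrite -sumE evP mul0r eqxx.
  by [].
have [tau tauP] := val_ex evP0; exists tau => //.
have [V1 V2] := val_mul tauP (emb_val piP).
rewrite sumE in V1 V2; have tE := has_val_inj V1 sumV.1.
rewrite tE sumV.2 in V2.
have {}t0L : T center t0 * (emb (D center)) sig * 'X =
    emb Q.[center] om * emb (\prod_(x <- O) D x) pi * (kappa%:P * 'X).
  have := (conj_center_contact 0).2; rewrite (act0 n' zeta center) H0 (level_in km' H0) => cE.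
  by rewrite -gl -t0L cE.
have X0 : 'X != 0 :> {poly K} by rewrite polyX_eq0.
rewrite mulrA in t0L; have := mulIf X0 t0L; rewrite V2 /= => EE.
set x := ev P tau in EE *.
have x0 : x != 0 by case: tauP.
have sz := congr1 (fun p : {poly K} => size p) EE.
move: sz; rewrite /= -!polyCM size_polyC -[x * _ * _]mulrA -polyCM [x * _]mulrC size_Cmul.
  rewrite !mulf_neq0 //; [by case: omP | by case: piP].
by rewrite mulf_neq0 //; [case: piP | case: sigP].
Qed.

Lemma val_add_eq (u v : B) p : has_val u p -> has_val v p -> (u + v) p != 0 ->
  has_val (u + v) p.
Proof.
move=> [_ hu] [_ hv] uvp; split=> // q; rewrite scoefD.
by case: (eqVneq (u q) 0) => [->|/hu //]; rewrite add0r => /hv.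
Qed.

(** Induction on the division of P by g.  The initial coefficient of Q(eta)
    g(eta) is divisible by the indeterminate and that of S(eta), with S the
    remainder, is a nonzero constant, so they do not cancel. *)
Lemma semiroot_degree g j (P : {poly A}) : semiroot g -> g \is monic -> size g = N.+1 ->
  P != 0 -> (size P <= j * N)%N ->
  exists2 tau, has_val (ev P) tau & (size ((ev P) tau) <= j)%N.
Proof.
move=> [gval [kappa k0 gl]] gm sg; elim: j P => [|j IH] P P0 sP.
  by move: sP; rewrite mul0n leqn0 size_poly_eq0 (negPf P0).
have PE := Pdiv.RingMonic.rdivp_eq gm P.
set Q := Pdiv.Ring.rdivp P g in PE; set S := Pdiv.Ring.rmodp P g in PE.
have sS : (size S <= N)%N by rewrite -ltnS -sg Pdiv.Ring.ltn_rmodp monic_neq0.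
have [Q0|Q0] := eqVneq Q 0.
  rewrite Q0 mul0r add0r in PE; rewrite PE in P0 *.
  by have [tau tauP s1] := low_degree P0 sS; exists tau; rewrite ?s1.
have sQ : (size Q <= j * N)%N.
  have := size_mul Q0 (monic_neq0 gm); rewrite sg addnS /= => sQg.
  rewrite -(leq_add2r N) -sQg (_ : Q * g = P - S); last by rewrite {1}PE addrK.
  apply: leq_trans (size_polyD _ _) _; rewrite size_polyN geq_max addnC -mulSn sP.
  by rewrite (leq_trans sS) // mulSn leq_addr.
have [t1 t1P s1] := IH Q Q0 sQ.
have [W1 W2] := val_mul t1P gval; rewrite -rmorphM gl in W1 W2.
have sW : (size (ev (Q * g) (t1 + rho)%MM) <= j.+1)%N.
  rewrite W2 mulrCA size_Cmul // size_mulX ?ltnS //.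
  by case: t1P.
have [S0|S0] := eqVneq S 0.
  by rewrite PE S0 addr0; exists (t1 + rho)%MM.
have [t2 t2P s2] := low_degree S0 sS.
rewrite PE rmorphD; have [E|tne] := eqVneq (t1 + rho)%MM t2.
  rewrite E in W1 W2 sW; exists t2; last first.
    by rewrite scoefD (leq_trans (size_polyD _ _)) // geq_max sW s2.
  apply: val_add_eq => //; rewrite scoefD W2.
  have /eqP/size_poly1P[a a0 ->] := s2.
  apply: contraNneq a0 => /(congr1 (fun p : {poly K} => p`_0)).
  by rewrite coefD coefC mulrCA coefCM coefMX /= mulr0 add0r coef0 => ->.
have [lt12|] := boolP (mlt (t1 + rho)%MM t2).
  have [|V1 V2] := @val_add _ _ _ (ev S) _ W1.
    by move=> q Sq; apply: mlt_le_trans lt12 (t2P.2 _ Sq).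
  by exists (t1 + rho)%MM; rewrite ?V2.
rewrite negbK mle_eqVlt eq_sym (negPf tne) /= => lt21.
have [|V1 V2] := @val_add _ _ _ (ev (Q * g)) _ t2P.
  by move=> q Sq; apply: mlt_le_trans lt21 (W1.2 _ Sq).
exists t2; first by rewrite addrC.
rewrite addrC. have -> : ev S t2 + ev (Q * g) t2 = ev S t2 by exact: V2.
by rewrite s2.
Qed.

(** Suppose that the exponent of q(eta) is at most r_k, and compare the
    coefficients of U^d, where U is the indeterminate, at the exponent p of q(eta) g(eta)^d.  Neither f(eta)
    nor g(eta)^(d+1) contributes, so r(eta) must cancel the middle term.  The
    initial coefficient of r(eta) has degree less than d, so the exponent of
    r(eta) is smaller than p; but there nothing is left to cancel it. *)
Lemma quotient_val f g q r d : semiroot g -> g \is monic -> size g = N.+1 ->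
  has_val (ev f) (rho *+ d.+1)%MM -> ((ev f) (rho *+ d.+1)%MM)`_d = 0 ->
  f = g ^+ d.+1 + q * g ^+ d + r -> q != 0 -> (size q <= N)%N ->
  (size r <= d * N)%N ->
  exists2 mu, has_val (ev q) mu & mlt rho mu.
Proof.
move=> gg gm sg fv fd fE q0 sq sr; have [gval [kappa k0 gl]] := gg.
have [mu muP smu] := low_degree q0 sq; exists mu => //; apply/negP => mr.
have [X1 X2] := val_exp d gval; have [Y1 Y2] := val_exp d.+1 gval.
have [W1 W2] := val_mul muP X1.
set p := (mu + rho *+ d)%MM in W1 W2.
have p_le : mle p (rho *+ d.+1)%MM by rewrite mulmS mle_add // mle_refl.
have rE : ev r = ev f - ev g ^+ d.+1 - ev q * ev g ^+ d.
  have aux (a b x : B) : x = (a + b + x) - a - b.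
    by rewrite [a + b + x]addrC -[RHS]addrA -opprD addrK.
  by rewrite fE !rmorphD rmorphM !rmorphXn /=; exact: aux.
have rlt t : mlt t p -> ev r t = 0.
  move=> tp; have tr := mlt_le_trans tp p_le.
  by rewrite rE !scoefB (val_gt fv tr) (val_gt Y1 tr) (val_gt W1 tp) !subr0.
have rp : (ev r p)`_d != 0.
  have [a a0 aE] : exists2 a, a != 0 & ev q mu = a%:P by apply/size_poly1P/eqP.
  have fp : (ev f p)`_d = 0.
    by move: p_le; rewrite mle_eqVlt => /orP[/eqP ->|/(val_gt fv) ->] //; rewrite coef0.
  have gp : ((ev g ^+ d.+1) p)`_d = 0.
    move: p_le; rewrite mle_eqVlt => /orP[/eqP ->|/(val_gt Y1) ->]; last by rewrite coef0.
    by rewrite Y2 gl exprMn -polyC_exp coefCM coefXn (ltn_eqF (ltnSn d)) mulr0.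
  have -> : (ev r p)`_d = - (a * kappa ^+ d).
    rewrite rE !scoefB !coefB fp gp subr0 sub0r W2 X2 gl aE exprMn -polyC_exp.
    by rewrite coefCM coefCM coefXn eqxx mulr1.
  by rewrite oppr_eq0 mulf_neq0 // expf_neq0.
have r0 : r != 0 by apply: contraNneq rp => ->; rewrite rmorph0 scoef0 coef0.
have [t tP st] := semiroot_degree gg gm sg r0 sr.
have tp : mle t p by apply: tP.2; apply: contraNneq rp => ->; rewrite coef0.
case: tP => rt _; case/negP: rt; apply/eqP; apply: rlt.
move: tp; rewrite mle_eqVlt => /orP[/eqP tE|//].
by case/negP: rp; rewrite -tE nth_default.
Qed.

Lemma leq_quotient_size a b c t s : t = (a + b)%N -> (s < a)%N ->
  (c + b <= t - s)%N -> (c <= a - s)%N.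
Proof. lia. Qed.

Lemma leq_remainder_size a b t s : t = (a + b)%N -> (s < a)%N -> (b <= t - s.+1)%N.
Proof. lia. Qed.

Lemma leq_binomial_term_size N s i d w x : (i < d.-1)%N -> (s < N)%N -> (w <= N - s)%N ->
  (x <= (w.-1 * i.+2).+1)%N ->
  (((N * (d - i.+2)).+1 + x).-1 <= N * d - s.+1)%N.
Proof.
case: d => // d /= id sN wN xw; have [c dE] : exists c, d = (i.+1 + c)%N by exists (d - i.+1)%N; lia.
have [t NE] : exists t, N = (s.+1 + t)%N by exists (N - s.+1)%N; lia.
have h : (w.-1 * i.+2 <= t * i.+2)%N by rewrite leq_mul2r; lia.
have -> : (d.+1 - i.+2 = c)%N by lia.
have -> : (N * d.+1 = N * c + s.+1 * i.+2 + t * i.+2)%N by rewrite dE NE; nia.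
nia.
Qed.

(** At step s the error f - g^d has degree less than n - s.  One Tschirnhausen
    step g + q/d removes the term q g^(d-1) and creates terms of higher order
    in q, whose degrees are smaller. *)
Lemma approximate_root (f : {poly A}) d : phi f = conjs_poly y -> f \is monic ->
  size f = n.+1 -> (d * #|stab y|)%N = #|Hk| ->
  exists g, [/\ (d %| n)%N, is_app_root d f g & semiroot g].
Proof.
move=> fE fm sf dE.
have [fv fd] := ev_root_poly fE (monic_neq0 fm) dE.
have H0 := card_Hset_gt0 n' m k.
have s0 : (0 < #|stab y|)%N by move: H0; rewrite -dE muln_gt0 => /andP[].
have d0 : (0 < d)%N by move: H0; rewrite -dE muln_gt0 => /andP[].
have nE : n = (N * d)%N.
  have so : size (conjs y) = n.
    have : size (phi f) = size f.
      by rewrite size_map_inj_poly ?rmorph0 //; exact: spow_inj.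
    by rewrite fE size_prod_XsubC sf => -[].
  have h1 := size_conjs zetaP y; rewrite so in h1.
  have h2 := size_conjs zetaP center; rewrite stab_center in h2.
  apply/eqP; rewrite -(eqn_pmul2r s0) -mulnA dE; apply/eqP.
  exact: etrans h1 (esym h2).
have N0 : (0 < N)%N by move: (conjs_self n' zeta center); case: O.
have sX (g : {poly A}) j : g \is monic -> size g = N.+1 -> size (g ^+ j) = (N * j).+1.
  move=> gm sg; have := size_exp g j; rewrite sg /= => <-.
  by rewrite prednK // size_poly_gt0 expf_neq0 // monic_neq0.
suff loop s : (s <= N)%N -> exists g : {poly A}, [/\ g \is monic, size g = N.+1, semiroot g
    & (size (f - g ^+ d)%R <= n - s)%N].
  have [g [gm sg gg gs]] := loop N (leqnn N); exists g.
  have nd : (n %/ d = N)%N by rewrite nE mulnK.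
  split=> //; first by rewrite nE dvdn_mull.
  by rewrite /is_app_root sf; split; rewrite ?nd.
elim: s => [_|s IH sN].
  have [g0 [_ gm sg gg]] := base_semiroot; exists g0; split=> //.
  rewrite subn0; apply/leq_sizeP => i; rewrite leq_eqVlt => /orP[/eqP <-|ni].
    have g1 : (g0 ^+ d)`_n = 1.
      by rewrite -(monicP (monic_exp d gm)) /lead_coef sX // -nE.
    by rewrite coefB g1 -(monicP fm) /lead_coef sf subrr.
  by rewrite coefB !nth_default ?subrr ?sf ?sX // -nE.
have [g [gm sg gg gs]] := IH (ltnW sN).
(* Series in x contain 1 / d, so q can be divided by d. *)
have [v vd] : exists v : A, v *+ d = 1.
  exists (MSeries (fun p => if p == 0%MM then d%:R^-1 else 0)).
  apply/mseriesP => p; rewrite scoefMn scoef1 /=; case: eqP => _.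
    by rewrite -[LHS]mulr_natr mulVf // char0_natr_neq0.
  by rewrite mul0rn.
have dP := prednK d0; set dd := d.-1 in dP.
have gdm := monic_exp dd gm.
have FE := Pdiv.RingMonic.rdivp_eq gdm (f - g ^+ d).
set q := Pdiv.Ring.rdivp _ _ in FE; set r := Pdiv.Ring.rmodp _ _ in FE.
have sr : (size r <= N * dd)%N.
  by rewrite -ltnS -(sX g) // Pdiv.Ring.ltn_rmodp monic_neq0.
have ndE : n = (N + N * dd)%N by rewrite nE -dP mulnS.
have [q0|q0] := eqVneq q 0.
  exists g; split=> //; rewrite FE q0 mul0r add0r (leq_trans sr) //.
  exact: (leq_remainder_size ndE sN).
have sq : (size q <= N - s)%N.
  have := size_mul q0 (monic_neq0 gdm); rewrite sX // addnS /= => sQg.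
  have : (size (q * g ^+ dd)%R <= n - s)%N.
    rewrite (_ : q * g ^+ dd = (f - g ^+ d) - r); last by rewrite {1}FE addrK.
    apply: leq_trans (size_polyD _ _) _; rewrite size_polyN geq_max gs.
    exact: leq_trans sr (leq_trans (leq_remainder_size ndE sN) (leq_sub2l _ (leqnSn s))).
  by rewrite sQg; apply: (leq_quotient_size ndE sN).
have [mu muP rmu] : exists2 mu, has_val (ev q) mu & mlt rho mu.
  apply: (@quotient_val f g q r dd) => //; rewrite ?dP //.
  - by rewrite -addrA -FE addrC subrK.
  - by rewrite (leq_trans sq) // leq_subr.
  - by rewrite mulnC.
pose w := v%:P * q.
have sw : (size w <= N - s)%N.
  by rewrite /w mul_polyC (leq_trans (size_scale_leq _ _)).
have swg : (size w < size g)%N by rewrite sg ltnS (leq_trans sw) // leq_subr.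
have wd : w *+ d = q by rewrite -mulrnAl -polyCMn vd mul1r.
exists (g + w); split.
- by rewrite monicE lead_coefDl.
- by rewrite size_polyDl.
- case: gg => gval [kappa k0 gl]; rewrite /semiroot rmorphD.
  have [|V1 V2] := @val_add _ _ _ (ev w) _ gval.
    move=> t; rewrite rmorphM => /supp_mul[a [b [-> _ qb]]].
    apply: mlt_le_trans rmu _; apply: mle_trans (muP.2 _ qb) _.
    exact/lem_mle/lem_addl.
  by split=> //; exists kappa; rewrite ?V2.
(* The terms of degree 0 and 1 in w are g^d and q g^(d-1). *)
have -> : f - (g + w) ^+ d = r - \sum_(i < d.-1) (g ^+ (d - i.+2) * w ^+ i.+2) *+ 'C(d, i.+2).
  rewrite exprDn -dP big_ord_recl big_ord_recl /= subn0 expr0 mulr1 bin0 mulr1n.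
  rewrite /bump /= subSS subn0 expr1 bin1 dP -mulrnAr wd.
  rewrite opprD addrA -[g ^+ _ * q]mulrC FE.
  by rewrite opprD addrA [q * _ + r]addrC addrK.
apply: leq_trans (size_polyD _ _) _; rewrite size_polyN geq_max; apply/andP; split.
  exact: leq_trans sr (leq_remainder_size ndE sN).
apply: leq_trans (size_sum _ _ _) _; apply/bigmax_leqP => i _.
rewrite -scaler_nat (leq_trans (size_scale_leq _ _)) //.
apply: leq_trans (size_polyMleq _ _) _.
have idd : (i < dd)%N := ltn_ord i.
rewrite sX // nE; apply: (leq_binomial_term_size idd sN sw); exact: size_poly_exp_leq.
Qed.

(** Evaluate the indeterminate at the coefficient of t^(m_k) in y. *)
Lemma semiroot_val g : semiroot g -> has_val (subst_eval n g y) rho.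
Proof.
case=> [[_ gval] [kappa k0 gl]].
pose sp := @smap {poly K} K e (horner_eval c).
have E : subst_eval n g y = sp (ev g).
  have etaE : sp eta = y.
    apply/mseriesP => p /=; rewrite /horner_eval; case: eqP => [->|_].
      by rewrite hornerX.
    by rewrite hornerC.
  have := horner_map (@smap {poly K} K e (horner_eval c)) (map_poly emb (phi g)) eta.
  rewrite /= -/sp etaE => <-; congr (_.[y]).
  apply/polyP => i; rewrite !coef_map; apply/mseriesP => p /=.
  by rewrite /horner_eval hornerC.
rewrite E; split=> [|q]; rewrite /= /horner_eval.
  by rewrite gl hornerM hornerC hornerX mulf_neq0 // c_neq0.
by move=> h; apply: gval; apply: contraNneq h => ->; rewrite horner0.
Qed.

End ApproximateRoots.

Lemma has_val_is_exp (R : comNzRingType) e (u : mseries R e) p : has_val u p -> is_exp u p.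
Proof.
move=> [up h]; exists (shomog u (mdeg p)).
  exists (mdeg p); split=> //.
    apply: contraNneq up => /(congr1 (fun w : mseries R e => w p)) /=.
    by rewrite eqxx => ->.
  move=> d dp; apply/mseriesP => q /=; case: eqP => // qd.
  apply/eqP; apply: contraLR dp => /h; rewrite /mle -leqNgt qd; lia.
split=> [|q]; rewrite /= ?eqxx //.
case: (mdeg q =P mdeg p) => [qp|]; last by rewrite eqxx.
move/h; rewrite /mle qp ltnn eqxx /= leEmnm qp.
by rewrite lexi_cons lexx.
Qed.

Theorem theorem4p3 (K : closedFieldType) (e n : nat)
    (f : {poly mseries K e}) (y : mseries K e) (m : seq 'X_{1..e})
    (charK : [pchar K] =i pred0)
    (f_monic : f \is monic)
    (f_deg : size f = n.+1)
    (f_irr : irreducible_elt f)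
    (f_qo : quasi_ordinary f)
    (y_root : subst_eval n f y = 0)
    (m_char : char_exponents n y m)
    (k : nat) (hk : (k < size m)%N) :
  is_O n y (app_root (dseq n m k) f) (rseq n m k).
Proof.
have m_notin : ~ in_lattice n m (fun j => j < k)%N (nth 0%MM m k).
  by case: m_char => _ _ _; apply.
have n1 : (1 < n)%N.
  case: n f_deg m_notin {y_root m_char} => [sf|[_|//]] h.
    case: f_irr => _ /negP fu _; case: fu; rewrite poly_unitE sf eqxx /=.
    by move: f_monic; rewrite monicE /lead_coef sf => /eqP ->; exact: unitr1.
  case: h; exists (fun a => (nth 0%MM m k a)%:Z), (fun _ => 0) => a.
  by rewrite mul1r big1 ?addr0 // => i _; rewrite mulr0.
case: n n1 f_deg y_root m_char m_notin => [//|[//|n']] _ f_deg y_root m_char _.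
have [zeta zetaP] := @prim_root_exists K n'.+2 charK isT.
have fE := irreducible_conjs_poly zetaP f_monic f_irr y_root.
have y_dom z : z \in conjs n' zeta y -> z != y -> exists q, has_dom (y - z) q.
  exact: (root_diff_dom charK f_monic f_deg f_qo fE).
have kh : (k <= size m)%N := ltnW hk.
have dE : (dseq n'.+2 m k * #|stab n' zeta y|)%N = #|Hset n' m k|.
  by rewrite (stab_y zetaP m_char) /dseq -!card_Hset divnK // card_Hset_dvd.
have d0 : (0 < dseq n'.+2 m k)%N.
  by have := card_Hset_gt0 n' m k; rewrite -dE muln_gt0 => /andP[].
have [g [dn gapp gg]] := approximate_root zetaP charK m_char y_dom hk fE f_monic f_deg dE.
have dA : (dseq n'.+2 m k)%:R != 0 :> mseries K e.
  apply: contraTneq (char0_natr_neq0 charK d0).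
  move=> /(congr1 (fun w : mseries K e => w 0%MM)); rewrite scoefMn scoef1 eqxx scoef0.
  by move=> ->; rewrite eqxx.
have nE : n'.+2 = (n'.+2 %/ dseq n'.+2 m k * dseq n'.+2 m k)%N by rewrite divnK.
rewrite (app_root_eq dA f_deg nE gapp).
exact/has_val_is_exp/(semiroot_val m_char hk gg).
Qed.
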